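(* Let $1\le s<n$, $T=\{2,\dots,s+1\}$, $S=\{1,\dots,2n+1\}\setminus T$, and let $so(2n+1,\mathbb C)$ act on $\mathcal A=\mathbb C[x_1,\dots,x_{2n+1}]$ by the representation attached to $(S,T)$ described in the context. Let $$\Delta=\partial_{x_1}^2-2\sum_{i=1}^sx_{i+1}\partial_{x_{n+i+1}}+2\sum_{j=s+1}^n\partial_{x_{j+1}}\partial_{x_{n+j+1}},\qquad\eta=x_1^2+2\sum_{i=1}^sx_{n+i+1}\partial_{x_{i+1}}+2\sum_{j=s+1}^nx_{j+1}x_{n+j+1},$$ and $\mathcal H_{\langle k\rangle}=\{f\in\mathcal A_{\langle k\rangle}\mid\Delta(f)=0\}$. Then for every $k\in\mathbb Z$, $\mathcal A_{\langle k\rangle}=\mathcal H_{\langle k\rangle}\oplus\eta\mathcal A_{\langle k-2\rangle}$, and $\mathcal H_{\langle k\rangle}$ is irreducible with basis the set of polynomials $$\sum_{r_2,\dots,r_{n+1}=0}^\infty\frac{(-1)^{r_{s+2}+\cdots+r_{n+1}}\,2^{r_2+\cdots+r_{n+1}}\,\epsilon!\,(r_2+\cdots+r_{n+1})!\prod_{j=s+1}^n\binom{\alpha_{j+1}}{r_{j+1}}r_{j+1}!\prod_{i=1}^n\binom{\alpha_{n+i+1}}{r_{i+1}}}{(\epsilon+2\sum_{i=1}^nr_{i+1})!}$$ $$\times x_1^{\epsilon+2\sum_{i=1}^nr_{i+1}}\prod_{i=1}^sx_{i+1}^{\alpha_{i+1}+r_{i+1}}x_{n+i+1}^{\alpha_{n+i+1}-r_{i+1}}\prod_{j=s+1}^nx_{j+1}^{\alpha_{j+1}-r_{j+1}}x_{n+j+1}^{\alpha_{n+j+1}-r_{j+1}},$$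 where $\epsilon\in\{0,1\}$, $\alpha_2,\dots,\alpha_{2n+1}\in\mathbb N$ and $\epsilon+\sum_{i=s+2}^{2n+1}\alpha_i-\sum_{i=2}^{s+1}\alpha_i=k$. If $k\ge0$, the highest weight of $\mathcal H_{\langle k\rangle}$ is $-(k+1)\lambda_s+k\lambda_{s+1}$ when $s<n-1$, and $-(k+1)\lambda_s+2k\lambda_{s+1}$ when $s=n-1$. When $k<0$, the highest weight of $\mathcal H_{\langle k\rangle}$ is $-k\lambda_{s-1}+(k-1)\lambda_s$. Moreover, $x_{s+2}^k$ is a singular vector of $\mathcal H_{\langle k\rangle}$ if $k\ge0$, and $x_{s+1}^{-k}$ is a singular vector of $\mathcal H_{\langle k\rangle}$ if $k<0$.
   Context: $\mathbb N$ denotes the nonnegative integers; $E_{i,j}$ are matrix units of size $2n+1$; $\binom ar=0$ for $r>a$. $\mathcal G=so(2n+1,\mathbb C)$ is the span of $E_{i+1,j+1}-E_{n+j+1,n+i+1}$ ($1\le i,j\le n$), $E_{i+1,n+j+1}-E_{j+1,n+i+1}$ and $E_{n+j+1,i+1}-E_{n+i+1,j+1}$ ($1\le i<j\le n$), $E_{i+1,1}-E_{1,n+i+1}$ and $E_{1,i+1}-E_{n+i+1,1}$ ($1\le i\le n$). Cartan subalgebra $H=\sum_{i=1}^n\mathbb C(E_{i+1,i+1}-E_{n+i+1,n+i+1})$; positive root vectors $E_{i+1,j+1}-E_{n+j+1,n+i+1}$, $E_{i+1,n+j+1}-E_{j+1,n+i+1}$ ($1\le i<j\le n$), $E_{i+1,1}-E_{1,n+i+1}$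 ($1\le i\le n$), spanning $\mathcal G_+$. With $h_i=E_{i+1,i+1}-E_{n+i+1,n+i+1}-E_{i+2,i+2}+E_{n+i+2,n+i+2}$ ($1\le i\le n-1$), $h_n=2(E_{n+1,n+1}-E_{2n+1,2n+1})$, the fundamental weights satisfy $\lambda_i(h_j)=\delta_{i,j}$; $\lambda_0=0$. The representation attached to a partition $(S,T)$ of $\{1,\dots,2n+1\}$ is the restriction to $\mathcal G$ of the representation of $gl(2n+1,\mathbb C)$ on $\mathcal A$: $E_{i,j}=x_i\partial_{x_j}$ if $i,j\in S$; $-x_ix_j$ if $i\in S,j\in T$; $\partial_{x_i}\partial_{x_j}$ if $i\in T,j\in S$; $-x_j\partial_{x_i}-\delta_{i,j}$ if $i,j\in T$. $\mathcal A_{\langle k\rangle}=\mathrm{Span}\{x^\alpha\mid\sum_{i\in S}\alpha_i-\sum_{i\in T}\alpha_i=k\}$. The operators $\Delta,\eta$ commute with $\mathcal G$. A singular vector is a nonzero $f$ with $H.f\subset\mathbb Cf$ and $\mathcal G_+.f=0$. The highest weight of an irreducible module containing a singular vector is the weight of that vector. *)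

(* Defs.v *)
From HB Require Import structures.
From mathcomp Require Import all_boot all_order all_algebra.
From mathcomp Require Import complex reals mpoly.

Set Implicit Arguments.
Unset Strict Implicit.
Unset Printing Implicit Defensive.
Import Order.TTheory GRing.Theory Num.Theory.
Local Open Scope ring_scope.

(* Vector subspaces of the (infinite-dimensional) space of polynomials are
   represented by predicates V -> Prop. *)

Definition lin_span (K : fieldType) (V : lmodType K) (B : V -> Prop) (v : V) : Prop :=
  exists m (b : 'I_m -> V) (c : 'I_m -> K),
    (forall i, B (b i)) /\ v = \sum_(i < m) c i *: b i.

Definition lin_indep (K : fieldType) (V : lmodType K) (B : V -> Prop) : Prop :=
  forall m (b : 'I_m -> V) (c : 'I_m -> K),
    injective b -> (forall i, B (b i)) ->
    \sum_(i < m) c i *: b i = 0 -> forall i, c i = 0.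

Definition is_basis (K : fieldType) (V : lmodType K) (W B : V -> Prop) : Prop :=
  lin_indep B /\ (forall v, W v <-> lin_span B v).

Definition is_subspace (K : fieldType) (V : lmodType K) (W : V -> Prop) : Prop :=
  W 0 /\ (forall (a : K) u v, W u -> W v -> W (a *: u + v)).

Definition is_direct_sum (V : zmodType) (W U1 U2 : V -> Prop) : Prop :=
  (forall v, W v <-> exists u1 u2, [/\ U1 u1, U2 u2 & v = u1 + u2]) /\
  (forall v, U1 v -> U2 v -> v = 0).

Definition image_of (V : Type) (phi : V -> V) (W : V -> Prop) (v : V) : Prop :=
  exists2 w, W w & v = phi w.

(* The mathematical indices 1, ..., 2n+1 are written as such (with type nat) in
   all formulas; [idx n p] is the ordinal, of value p - 1, that stands for p. *)
Definition idx (n p : nat) : 'I_(n.*2.+1) := inord p.-1.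

Section Liealgebra.
Context (K : fieldType) (n : nat).

Definition Emx (p q : nat) : 'M[K]_(n.*2.+1) := delta_mx (idx n p) (idx n q).
Local Notation E := Emx.

Inductive so_pos_root : 'M[K]_(n.*2.+1) -> Prop :=
| PosRootMinus i j of (1 <= i)%N & (i < j)%N & (j <= n)%N :
    so_pos_root (E i.+1 j.+1 - E (n + j.+1) (n + i.+1))
| PosRootPlus i j of (1 <= i)%N & (i < j)%N & (j <= n)%N :
    so_pos_root (E i.+1 (n + j.+1) - E j.+1 (n + i.+1))
| PosRootShort i of (1 <= i)%N & (i <= n)%N :
    so_pos_root (E i.+1 1 - E 1 (n + i.+1)).

Inductive so_gen : 'M[K]_(n.*2.+1) -> Prop :=
| SoDiag i j of (1 <= i)%N & (i <= n)%N & (1 <= j)%N & (j <= n)%N :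
    so_gen (E i.+1 j.+1 - E (n + j.+1) (n + i.+1))
| SoUpper i j of (1 <= i)%N & (i < j)%N & (j <= n)%N :
    so_gen (E i.+1 (n + j.+1) - E j.+1 (n + i.+1))
| SoLower i j of (1 <= i)%N & (i < j)%N & (j <= n)%N :
    so_gen (E (n + j.+1) i.+1 - E (n + i.+1) j.+1)
| SoCol i of (1 <= i)%N & (i <= n)%N :
    so_gen (E i.+1 1 - E 1 (n + i.+1))
| SoRow i of (1 <= i)%N & (i <= n)%N :
    so_gen (E 1 i.+1 - E (n + i.+1) 1).

Inductive cartan_gen : 'M[K]_(n.*2.+1) -> Prop :=
| CartanGen i of (1 <= i)%N & (i <= n)%N :
    cartan_gen (E i.+1 i.+1 - E (n + i.+1) (n + i.+1)).

Definition so : 'M[K]_(n.*2.+1) -> Prop := lin_span so_gen.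
Definition so_pos : 'M[K]_(n.*2.+1) -> Prop := lin_span so_pos_root.
Definition cartan : 'M[K]_(n.*2.+1) -> Prop := lin_span cartan_gen.

Definition coroot (i : nat) : 'M[K]_(n.*2.+1) :=
  if (i < n)%N then
    E i.+1 i.+1 - E (n + i.+1) (n + i.+1)
      - E i.+2 i.+2 + E (n + i.+2) (n + i.+2)
  else 2 *: (E n.+1 n.+1 - E n.*2.+1 n.*2.+1).

(* Weights are linear forms on the Cartan subalgebra; here they are linear
   forms on all matrices of which only the values on [cartan] are used. *)
Definition fundamental_weights (lam : nat -> {scalar 'M[K]_(n.*2.+1)}) : Prop :=
  (forall h, cartan h -> lam 0%N h = 0) /\
  (forall i j, (1 <= i <= n)%N -> (1 <= j <= n)%N ->
     lam i (coroot j) = (i == j)%:R).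

End Liealgebra.

Section Oscillator.
Context (K : fieldType) (m : nat) (T : {set 'I_m}).
Local Notation A := {mpoly K[m]}.

(* The action of the matrix unit E_{i,j} of gl(m), S being the complement of T. *)
Definition unit_act (i j : 'I_m) (f : A) : A :=
  match i \in T, j \in T with
  | false, false => 'X_i * f^`M(j)
  | false, true => - ('X_i * 'X_j * f)
  | true, false => f^`M(j)^`M(i)
  | true, true => - ('X_j * f^`M(i)) - (i == j)%:R *: f
  end.

Definition gl_act (M : 'M[K]_m) (f : A) : A :=
  \sum_(i < m) \sum_(j < m) M i j *: unit_act i j f.

Definition grade (a : 'X_{1..m}) : int :=
  \sum_(i | i \notin T) (a i)%:Z - \sum_(i in T) (a i)%:Z.

Definition A_graded (k : int) : A -> Prop :=
  lin_span (fun f : A => exists2 a, grade a = k & f = 'X_[a]).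

End Oscillator.

Section Modules.
Context (K : fieldType) (n : nat) (T : {set 'I_(n.*2.+1)}).
Local Notation A := {mpoly K[n.*2.+1]}.
Local Notation act := (gl_act T).

Definition so_submodule (W : A -> Prop) : Prop :=
  is_subspace W /\ (forall g f, so g -> W f -> W (act g f)).

Definition so_irreducible (W : A -> Prop) : Prop :=
  [/\ so_submodule W,
      exists2 f, W f & f != 0 &
      forall U : A -> Prop, so_submodule U -> (forall f, U f -> W f) ->
        (forall f, U f -> f = 0) \/ (forall f, W f -> U f)].

Definition singular_vector (f : A) : Prop :=
  [/\ f != 0,
      forall h, cartan h -> exists c : K, act h f = c *: f &
      forall g, so_pos g -> act g f = 0].

Definition has_weight (mu : 'M[K]_(n.*2.+1) -> K) (f : A) : Prop :=
  forall h, cartan h -> act h f = mu h *: f.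

Definition highest_weight (W : A -> Prop) (mu : 'M[K]_(n.*2.+1) -> K) : Prop :=
  so_irreducible W /\ (exists f, [/\ W f, singular_vector f & has_weight mu f]).

End Modules.

Section Harmonic.
Context (K : fieldType) (n s : nat).
Local Notation A := {mpoly K[n.*2.+1]}.

Definition Tset : {set 'I_(n.*2.+1)} :=
  [set i : 'I_(n.*2.+1) | (2 <= i.+1 <= s.+1)%N].

Local Notation x p := ('X_(idx n p) : A).
Local Notation d p f := (f^`M(idx n p) : A).

Definition Delta_op (f : A) : A :=
  d 1 (d 1 f)
  - 2 *: (\sum_(1 <= i < s.+1) x i.+1 * d (n + i.+1) f)
  + 2 *: (\sum_(s.+1 <= j < n.+1) d j.+1 (d (n + j.+1) f)).

Definition eta_op (f : A) : A :=
  x 1 ^+ 2 * f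
  + 2 *: (\sum_(1 <= i < s.+1) x (n + i.+1) * d i.+1 f)
  + 2 *: (\sum_(s.+1 <= j < n.+1) x j.+1 * x (n + j.+1) * f).

Definition H_graded (k : int) (f : A) : Prop :=
  A_graded Tset k f /\ Delta_op f = 0.

(* The summand with indices r_2, ..., r_{n+1}. A truncated exponent a - r < 0
   only occurs when the corresponding binomial coefficient is 0. *)
Definition basis_term (eps : nat) (a r : nat -> nat) : A :=
  let m := (\sum_(2 <= p < n.+2) r p)%N in
  let e := (eps + 2 * \sum_(1 <= i < n.+1) r i.+1)%N in
  ((-1) ^+ (\sum_(s.+2 <= p < n.+2) r p)%N * 2 ^+ m * (eps`! * m`!)%N%:R
   * (\prod_(s.+1 <= j < n.+1) ('C(a j.+1, r j.+1) * (r j.+1)`!))%N%:R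
   * (\prod_(1 <= i < n.+1) 'C(a (n + i.+1)%N, r i.+1))%N%:R
   / (e`!)%:R : K)
  *: (x 1 ^+ e
      * (\prod_(1 <= i < s.+1)
           (x i.+1 ^+ (a i.+1 + r i.+1)
            * x (n + i.+1) ^+ (a (n + i.+1)%N - r i.+1)))
      * (\prod_(s.+1 <= j < n.+1)
           (x j.+1 ^+ (a j.+1 - r j.+1)
            * x (n + j.+1) ^+ (a (n + j.+1)%N - r j.+1)))).

(* The summand vanishes unless r_{i+1} <= a_{n+i+1} for 1 <= i <= n, so the sum
   over all r is a sum over the r with entries at most a_2 + ... + a_{2n+1}.
   The tuple r lists r_2, ..., r_{n+1}. *)
Definition basis_poly (eps : nat) (a : nat -> nat) : A :=
  \sum_(r : n.-tuple 'I_(\sum_(2 <= p < n.*2.+2) a p)%N.+1)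
     basis_term eps a (fun p => nth 0%N (map val r) (p - 2)%N).

(* Only the values a_2, ..., a_{2n+1} of a : nat -> nat matter. *)
Definition H_basis_set (k : int) (f : A) : Prop :=
  exists (eps : nat) (a : nat -> nat),
    [/\ (eps <= 1)%N,
        eps%:Z + \sum_(s.+2 <= p < n.*2.+2) (a p)%:Z
          - \sum_(2 <= p < s.+2) (a p)%:Z = k &
        f = basis_poly eps a].

End Harmonic.

Lemma fundamental_weights_exist (K : numFieldType) (n : nat) :
  exists lam : nat -> {scalar 'M[K]_(n.*2.+1)}, fundamental_weights lam.
Proof.
pose c i : K := if (i < n)%N then 1 else 2^-1.
pose w i : 'M[K]_(n.*2.+1) :=
  diag_mx (\row_q (c i *+ (1 <= (q : nat) <= i)%N)).
pose lam i : {scalar 'M[K]_(n.*2.+1)} := mxtrace \o mulmx (w i).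
have lamE i p : (p <= n.*2)%N ->
  lam i (Emx K n p.+1 p.+1) = c i *+ (1 <= p <= i)%N.
  move=> pn; have ip : (idx n p.+1 : nat) = p by rewrite /= inordK.
  rewrite /= /mxtrace (bigD1 (idx n p.+1)) //= big1 => [|q qp].
    by rewrite addr0 mul_diag_mx !mxE !eqxx mulr1 ip.
  by rewrite mul_diag_mx !mxE (negPf qp) mulr0.
have le2 i : (i <= n)%N -> (n + i <= n.*2)%N.
  by move=> ?; rewrite -addnn leq_add2l.
have le1 i : (i <= n)%N -> (i <= n.*2)%N.
  by move=> /le2; apply: leq_trans; rewrite leq_addl.
have far i j : (i <= n)%N -> (0 < j)%N -> (1 <= n + j <= i)%N = false.
  move=> le_in j0; apply/negP => /andP[_ h].
  by move: (leq_trans h le_in); rewrite -{2}[n]addn0 leq_add2l leqNgt j0.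
exists lam; split=> [h _|i j /andP[i1 le_in] /andP[j1 le_jn]].
  rewrite /= (_ : w 0%N = 0) ?mul0mx ?mxtrace0 //.
  apply/matrixP=> p q; rewrite !mxE.
  by case: (p : nat) => [|?]; rewrite ?mulr0n ?mul0rn //= mulr0n mul0rn.
rewrite /coroot; case: ifP => [lt_jn|/negbT].
  have le2S := le2 _ lt_jn; have le2j := le2 _ le_jn; rewrite !addnS in le2S *.
  rewrite linearD !linearB !lamE ?le2j ?le2S ?le1 // -addnS.
  rewrite !far // !mulr0n subr0 addr0 j1 /=.
  have [->|] := eqVneq i j; first by rewrite leqnn ltnn subr0 /c lt_jn.
  rewrite neq_ltn => /orP[lt|lt].
    by rewrite leqNgt lt /= leqNgt ltnS ltnW // subr0.
  by rewrite (ltnW lt) lt subrr.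
rewrite -leqNgt => le_nj; have -> : j = n by apply/eqP; rewrite eqn_leq le_jn.
have n0 : (0 < n)%N by apply: leq_trans j1 le_jn.
have far2 : (n.*2 <= i)%N = false.
  by apply/negP => /leq_trans/(_ le_in); rewrite -addnn -{3}[n]addn0 leq_add2l leqNgt n0.
rewrite linearZ linearB !lamE // ?le1 // ?n0 ?double_gt0 ?n0 /= far2 mulr0n subr0 /c.
have [->|ne] := eqVneq i n; first by rewrite leqnn ltnn mulr1n /= mulfV ?pnatr_eq0.
by rewrite (leqNgt n) ltn_neqAle ne le_in mulr0n /= mulr0.
Qed.

(* Main.v *)
Require Import Defs.
From HB Require Import structures.
From mathcomp Require Import all_boot all_order all_algebra.
From mathcomp Require Import complex reals mpoly.
From mathcomp Require Import ring zify.

Set Implicit Arguments.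
Unset Strict Implicit.
Unset Printing Implicit Defensive.
Import Order.TTheory GRing.Theory Num.Theory.
Local Open Scope ring_scope.



(** Write [X_a, P_a] for the Weyl generators with [E_{a,b} = X_a P_b], and [sg] for the
involution pairing the index [i+1] with [n+i+1] and fixing [1]. Then so(2n+1) is spanned by
the [X_a P_b - X_{sg b} P_{sg a}], while [Delta] is the sum of the [P_{sg b} P_b] and [eta] that
of the [X_b X_{sg b}].

[Delta] and [eta] generate an sl2 whose weights on the graded pieces are never 0, so that
[Delta eta] is bijective on each of them; this gives the direct sum.

A nonzero element of a submodule of [H_k] that is minimal for a suitable weighted degree is
killed by all lowering operators. Combining the resulting equations with [Delta f = 0] yields
eigenvalue equations for [P_{sg a} f]: a parity argument (2n+1 is odd) or positivity forces
[P_{sg a} f = 0], and [f] is a multiple of the monomial singular vector. Now [Delta] is adjoint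
to [eta] for a nondegenerate form that is diagonal on monomials and invariant up to signs, so
a proper submodule would have a nonzero orthogonal in [H_k]; both would contain the monomial
singular vector, which is not isotropic.

Finally an element of [H_k] is determined by its coefficients of degree at most 1 in [x_1], and
the basis polynomials realize exactly the monomials there. *)

(** Two points shape the proof. First, the graded pieces are infinite-dimensional, so it is not
    clear that a proper submodule has a nonzero orthogonal. The remedy is [degT], the degree in the
    variables x_i with i in T or sg i in T: up to a constant it is the action of a Cartan element,
    so submodules are stable under its projections, and together with the grade it leaves only
    finitely many monomials. A vector is then separated from a submodule in finite dimension, and
    only the harmonic part of the separating polynomial matters, because H_k is orthogonal to the
    image of eta. Second, the eigenvalue equations come from applying Delta to X_a f: for harmonic f
    the result is 2 P_{sg a} f, while the killing equations turn each summand of Delta into an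
    operator P_c X_c, diagonal on monomials, applied to P_{sg a} f. Every monomial of P_{sg a} f
    must therefore satisfy one numerical identity with right-hand side 2. *)

(** * Weyl algebra generators and the action of gl(2n+1) *)

Section Weyl.
Context (K : numFieldType) (m : nat) (T : {set 'I_m}).
Local Notation A := {mpoly K[m]}.

(** On T the pair (x, d) is replaced by (d, -x), which keeps the relation [P_a, X_b] = delta_{ab}.
    All four cases of [unit_act] thus become the single formula X_a P_b. *)
Definition weylX (a : 'I_m) (f : A) : A := if a \in T then f^`M(a) else 'X_a * f.
Definition weylP (a : 'I_m) (f : A) : A := if a \in T then - ('X_a * f) else f^`M(a).

Fact weylX_is_linear a : linear (weylX a).
Proof.
by move=> c f g; rewrite /weylX; case: ifP => _; rewrite ?linearP // mulrDr scalerAr.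
Qed.
HB.instance Definition _ a :=
  GRing.isLinear.Build K A A _ (weylX a) (weylX_is_linear a).

Fact weylP_is_linear a : linear (weylP a).
Proof.
move=> c f g; rewrite /weylP; case: ifP => _; rewrite ?linearP //=.
by rewrite mulrDr scalerN opprD -scalerAr.
Qed.
HB.instance Definition _ a :=
  GRing.isLinear.Build K A A _ (weylP a) (weylP_is_linear a).

Lemma mderiv_mulX a b (f : A) :
  ('X_b * f)^`M(a) = 'X_b * f^`M(a) + (a == b)%:R *: f.
Proof.
rewrite mderivM mderivX mnm1E addrC eq_sym; congr (_ + _).
case: eqP => [->|_]; last by rewrite !scale0r mul0r.
by rewrite -{1}[U_(b)%MM]add0m addmK mpolyX0 scale1r mul1r scale1r.
Qed.

Lemma weylXC a b f : weylX a (weylX b f) = weylX b (weylX a f).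
Proof.
rewrite /weylX; case: ifP => aT; case: ifP => bT; rewrite ?mderiv_mulX //.
- exact: mderiv_comm.
- by case: eqP aT bT => [->->//|]; rewrite scale0r addr0.
- by case: eqP aT bT => [->->//|]; rewrite scale0r addr0.
- by rewrite mulrCA.
Qed.

Lemma weylPC a b f : weylP a (weylP b f) = weylP b (weylP a f).
Proof.
rewrite /weylP; case: ifP => aT; case: ifP => bT; rewrite ?mderivN ?mderiv_mulX //.
- by rewrite !mulrN mulrCA.
- by case: eqP aT bT => [->->//|]; rewrite scale0r addr0.
- by case: eqP aT bT => [->->//|]; rewrite scale0r addr0.
- exact: mderiv_comm.
Qed.

Lemma weylPX a b f :
  weylP a (weylX b f) = weylX b (weylP a f) + (a == b)%:R *: f.
Proof.
rewrite /weylP /weylX; case: ifP => aT; case: ifP => bT; rewrite ?mderivN ?mderiv_mulX //.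
- by rewrite eq_sym opprD addrNK.
- by case: eqP aT bT => [->->//|]; rewrite scale0r addr0 mulrN mulrCA.
- by case: eqP aT bT => [->->//|]; rewrite scale0r addr0 mderiv_comm.
Qed.

Lemma unit_actE a b f : unit_act T a b f = weylX a (weylP b f).
Proof.
rewrite /unit_act /weylX /weylP; case: (a \in T); case: (b \in T) => //.
- by rewrite mderivN mderiv_mulX opprD.
- by rewrite mulrN mulrA.
Qed.

Lemma gl_act_linear f : linear (fun M : 'M[K]_m => gl_act T M f).
Proof.
move=> c M N; rewrite /gl_act scaler_sumr -big_split; apply: eq_bigr => a _ /=.
rewrite scaler_sumr -big_split; apply: eq_bigr => b _ /=.
by rewrite !mxE scalerDl scalerA.
Qed.

Lemma gl_act_delta a b f : gl_act T (delta_mx a b) f = weylX a (weylP b f).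
Proof.
rewrite /gl_act (bigD1 a) //= [X in _ + X]big1 => [|i ia]; last first.
  by rewrite big1 // => j _; rewrite mxE (negPf ia) scale0r.
rewrite (bigD1 b) //= big1 => [|j jb]; last by rewrite mxE (negPf jb) andbF scale0r.
by rewrite mxE !eqxx scale1r !addr0 unit_actE.
Qed.

End Weyl.

(** * The index involution *)

Section Indices.
Context (n : nat).
Local Notation I := 'I_(n.*2.+1).

(** Ordinals are zero-based: value 0 stands for the index 1, and values i and n + i for the indices
    i+1 and n+i+1. *)
Definition sg (a : I) : I :=
  inord (if a == 0%N :> nat then 0%N else if (a <= n)%N then (a + n)%N else (a - n)%N).

Lemma val_sg a : sg a =
  (if a == 0%N :> nat then 0%N else if (a <= n)%N then (a + n)%N else (a - n)%N) :> nat.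
Proof.
rewrite /sg inordK //; have := ltn_ord a.
by case: ifP => // ?; case: ifP => ?; lia.
Qed.

Lemma sgK : involutive sg.
Proof.
move=> a; apply: val_inj; rewrite /= !val_sg; have := ltn_ord a.
case: (eqVneq (a : nat) 0%N) => [->//|a0]; case: (leqP a n) => ha.
  by case: ifP => ?; [|case: ifP => ?]; lia.
by case: ifP => ?; [|case: ifP => ?]; lia.
Qed.

Lemma val_idx p : (p <= n.*2.+1)%N -> idx n p = p.-1 :> nat.
Proof. by move=> pn; rewrite inordK //; lia. Qed.

Lemma sg_idx1 : sg (idx n 1) = idx n 1.
Proof. by apply: val_inj; rewrite /= val_sg val_idx. Qed.

Lemma sg_idx_lo i : (1 <= i <= n)%N -> sg (idx n i.+1) = idx n (n + i.+1).
Proof.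
move=> ?; apply: val_inj; rewrite /= val_sg !val_idx /=; try lia.
by case: eqP => ?; [|case: ifP => ?]; lia.
Qed.

Lemma sg_idx_hi i : (1 <= i <= n)%N -> sg (idx n (n + i.+1)) = idx n i.+1.
Proof. by move=> ?; rewrite -sg_idx_lo // sgK. Qed.

Variant idx_spec (a : I) : Prop :=
| IdxOne of a = idx n 1 & sg a = idx n 1
| IdxLo i of (1 <= i <= n)%N & a = idx n i.+1 & sg a = idx n (n + i.+1)
| IdxHi i of (1 <= i <= n)%N & a = idx n (n + i.+1) & sg a = idx n i.+1.

Lemma idxP a : idx_spec a.
Proof.
have aidx : a = idx n a.+1 by apply: val_inj; rewrite /= val_idx.
have an := ltn_ord a.
case: (posnP a) => [a0|a0].
  by rewrite a0 in aidx; apply: IdxOne => //; rewrite aidx sg_idx1.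
case: (leqP a n) => [le_an|lt_na].
  by apply: (@IdxLo _ a) => //; [rewrite a0 | rewrite {1}aidx sg_idx_lo // a0].
have {}aidx : a = idx n (n + (a - n).+1) by rewrite {1}aidx; congr idx; lia.
by apply: (@IdxHi _ (a - n)%N) => //; [lia | rewrite {1}aidx sg_idx_hi //; lia].
Qed.

Lemma eq_idx p q : (1 <= p <= n.*2.+1)%N -> (1 <= q <= n.*2.+1)%N ->
  (idx n p == idx n q) = (p == q).
Proof. by move=> ? ?; rewrite -val_eqE /= !val_idx; lia. Qed.

(** Splits a big operator along the orbits of [sg]: one fixed point and n pairs. *)
Lemma big_idx (R : Type) (z : R) (op : Monoid.com_law z) (F : I -> R) :
  \big[op/z]_a F a = op (F (idx n 1))
    (\big[op/z]_(1 <= i < n.+1) op (F (idx n i.+1)) (F (idx n (n + i.+1)))).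
Proof.
transitivity (\big[op/z]_(0 <= j < n.*2.+1) F (inord j)).
  by rewrite big_mkord; apply: eq_bigr => a _; rewrite inord_val.
rewrite big_ltn // /idx /=; congr (op _ _).
rewrite (@big_cat_nat _ _ _ n.+1) /=; [|lia|lia].
rewrite big_split /=; congr (op _ _).
have := @big_addn R z op 1 n.*2.+1 n xpredT (fun i => F (inord i)); rewrite add1n => ->.
rewrite (_ : (n.*2.+1 - n = n.+1)%N); last by lia.
by apply: eq_bigr => i _; congr (F (inord _)); lia.
Qed.

Lemma idx_Tset s p : (1 <= p <= n.*2.+1)%N ->
  (idx n p \in Tset n s) = (2 <= p <= s.+1)%N.
Proof. by move=> ?; rewrite inE val_idx; lia. Qed.

End Indices.

(** * The orthogonal Lie algebra and its action *)

Section SoAction.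
Context (K : numFieldType) (n : nat).
Local Notation I := 'I_(n.*2.+1).
Local Notation A := {mpoly K[n.*2.+1]}.

Definition so_mx (a b : I) : 'M[K]_(n.*2.+1) := delta_mx a b - delta_mx (sg b) (sg a).

Lemma so_mx_sg a b : so_mx (sg b) (sg a) = - so_mx a b.
Proof. by rewrite /so_mx !sgK opprB. Qed.

Lemma so_gen_mx g : so_gen g -> exists a b, g = so_mx a b.
Proof.
case=> [i j|i j|i j|i|i] *.
- by exists (idx n i.+1), (idx n j.+1); rewrite /so_mx !sg_idx_lo //; lia.
- exists (idx n i.+1), (idx n (n + j.+1)).
  by rewrite /so_mx sg_idx_lo ?sg_idx_hi //; lia.
- exists (idx n (n + j.+1)), (idx n i.+1).
  by rewrite /so_mx sg_idx_lo ?sg_idx_hi //; lia.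
- by exists (idx n i.+1), (idx n 1); rewrite /so_mx sg_idx1 sg_idx_lo //; lia.
- by exists (idx n 1), (idx n i.+1); rewrite /so_mx sg_idx1 sg_idx_lo //; lia.
Qed.

(** By [so_mx_sg] the pairs (a, b) and (sg b, sg a) give opposite matrices, whence the sign; the
    zero case is b = sg a. *)
Lemma so_mx_gen a b : [\/ so_mx a b = 0, so_gen (so_mx a b) | so_gen (- so_mx a b)].
Proof.
rewrite -so_mx_sg.
rewrite /so_mx !sgK.
case: (idxP a) => [ea sa|i hi ea sa|i hi ea sa];
  case: (idxP b) => [eb sb|j hj eb sb|j hj eb sb]; rewrite sa sb ea eb.
- by apply: Or31; rewrite subrr.
- by apply: Or32; apply: SoRow; lia.
- by apply: Or33; apply: SoCol; lia.
- by apply: Or32; apply: SoCol; lia.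
- by apply: Or32; apply: SoDiag; lia.
- case: (ltngtP i j) => ij; last by apply: Or31; rewrite ij subrr.
  + by apply: Or32; apply: SoUpper; lia.
  + by apply: Or33; apply: SoUpper; lia.
- by apply: Or33; apply: SoRow; lia.
- case: (ltngtP i j) => ij; last by apply: Or31; rewrite ij subrr.
  + by apply: Or33; apply: SoLower; lia.
  + by apply: Or32; apply: SoLower; lia.
- by apply: Or33; apply: SoDiag; lia.
Qed.

Context (T : {set I}).
Local Notation X := (weylX T).
Local Notation P := (weylP T).

Definition so_op (a b : I) (f : A) : A := X a (P b f) - X (sg b) (P (sg a) f).

Fact so_op_is_linear a b : linear (so_op a b).
Proof. by move=> c f g; rewrite /so_op !linearP /= scalerDr addrACA. Qed.
HB.instance Definition _ a b :=
  GRing.isLinear.Build K A A _ (so_op a b) (so_op_is_linear a b).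

(** The arguments are exchanged so that linearity in the matrix can be declared as an instance. *)
Definition gl_act_at (f : A) (M : 'M[K]_(n.*2.+1)) : A := gl_act T M f.

HB.instance Definition _ f :=
  GRing.isLinear.Build K _ A _ (gl_act_at f) (gl_act_linear T f).

Lemma gl_act_sum f m c (M : 'I_m -> 'M[K]_(n.*2.+1)) :
  gl_act T (\sum_i c i *: M i) f = \sum_i c i *: gl_act T (M i) f.
Proof.
rewrite -/(gl_act_at f _) linear_sum; apply: eq_bigr => i _.
exact: (linearZ_LR (gl_act_at f)).
Qed.

Lemma gl_act_so_mx a b f : gl_act T (so_mx a b) f = so_op a b f.
Proof. by rewrite -/(gl_act_at f _) linearB /= /gl_act_at !gl_act_delta. Qed.

Lemma subspace_sum (W : A -> Prop) m (c : 'I_m -> K) f :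
  is_subspace W -> (forall i, W (f i)) -> W (\sum_i c i *: f i).
Proof.
move=> [W0 WD] Wf; apply: big_ind => // [x y Wx Wy|i _].
  by rewrite -[x]scale1r; apply: WD.
by rewrite -[_ *: _]addr0; apply: WD.
Qed.

Lemma so_submoduleP (W : A -> Prop) :
  so_submodule T W <-> is_subspace W /\ forall a b f, W f -> W (so_op a b f).
Proof.
split=> -[subW WM]; [split=> // a b f Wf | split=> // g f [m [b [c [gb ->]]]] Wf].
  rewrite -gl_act_so_mx; case: (so_mx_gen a b) => [->|gen|gen].
  - by rewrite -/(gl_act_at f _) linear0; case: subW.
  - by apply: WM => //; exists 1%N, (fun=> so_mx a b), (fun=> 1); rewrite big_ord1 scale1r.
  - rewrite -[so_mx a b]opprK; apply: WM => //.
    by exists 1%N, (fun=> - so_mx a b), (fun=> -1); rewrite big_ord1 scaleN1r.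
rewrite gl_act_sum; apply: subspace_sum => // i.
by have [p [q ->]] := so_gen_mx (gb i); rewrite gl_act_so_mx; apply: WM.
Qed.

End SoAction.

(** * Weighted degrees of polynomials *)

Section Supports.
Context (K : numFieldType) (m : nat).
Local Notation A := {mpoly K[m]}.
Implicit Types (f g : A) (mu : 'X_{1..m}) (a : 'I_m) (w : 'I_m -> int) (k : int).

Lemma mnm_subK a mu : (0 < mu a)%N -> (mu - U_(a) + U_(a) = mu)%MM.
Proof.
move=> a0; apply: submK; apply/mnm_lepP => i; rewrite mnm1E.
by case: eqP => [<-|].
Qed.

Lemma mcoeff_mulX a f mu :
  ('X_a * f)@_mu = if (0 < mu a)%N then f@_(mu - U_(a)) else 0.
Proof.
case: posnP => [a0|a0]; last by rewrite mulrC -{1}(mnm_subK a0) addmC mcoeffMX.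
apply: memN_msupp_eq0; rewrite mulrC (perm_mem (msuppMX _ _)).
by apply/mapP => -[nu _ E]; move: a0; rewrite E mnmDE mnm1E eqxx.
Qed.

Definition wdeg w mu : int := \sum_a w a * (mu a)%:Z.

Lemma wdegDU w mu a : wdeg w (mu + U_(a)) = wdeg w mu + w a.
Proof.
rewrite /wdeg; under eq_bigr do rewrite mnmDE PoszD mulrDr.
rewrite big_split /=; congr (_ + _); rewrite (bigD1 a) //= big1 ?addr0.
  by rewrite mnm1E eqxx mulr1.
by move=> b ba; rewrite mnm1E eq_sym (negPf ba) mulr0.
Qed.

Definition isobaric w k f := forall mu, f@_mu != 0 -> wdeg w mu = k.
Definition below w k f := forall mu, f@_mu != 0 -> wdeg w mu < k.

Lemma isobaric_lin w k c f g : isobaric w k f -> isobaric w k g -> isobaric w k (c *: f + g).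
Proof.
move=> hf hg mu; rewrite mcoeffD mcoeffZ.
have [->|/hf//] := eqVneq f@_mu 0; rewrite mulr0 add0r; exact: hg.
Qed.

Lemma isobaric0 w k : isobaric w k 0.
Proof. by move=> mu; rewrite mcoeff0 eqxx. Qed.

Lemma isobaricZ w k c f : isobaric w k f -> isobaric w k (c *: f).
Proof. by move=> hf; rewrite -[_ *: _]addr0; apply: isobaric_lin => //; apply: isobaric0. Qed.

Lemma isobaricN w k f : isobaric w k f -> isobaric w k (- f).
Proof. by rewrite -scaleN1r; apply: isobaricZ. Qed.

Lemma isobaricD w k f g : isobaric w k f -> isobaric w k g -> isobaric w k (f + g).
Proof. by rewrite -[f in f + g]scale1r; apply: isobaric_lin. Qed.

Lemma isobaric_sum w k (J : Type) (r : seq J) (Q : pred J) (F : J -> A) :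
  (forall j, Q j -> isobaric w k (F j)) -> isobaric w k (\sum_(j <- r | Q j) F j).
Proof. by move=> hF; apply: big_ind => //; [apply: isobaric0 | apply: isobaricD]. Qed.

Lemma isobaric_mulX w k a f : isobaric w k f -> isobaric w (k + w a) ('X_a * f).
Proof.
move=> hf mu; rewrite mcoeff_mulX; case: ifP => [a0 /hf <-|]; last by rewrite eqxx.
by rewrite -wdegDU mnm_subK.
Qed.

Lemma isobaric_deriv w k a f : isobaric w k f -> isobaric w (k - w a) f^`M(a).
Proof.
move=> hf mu; rewrite mcoeff_deriv mulrn_eq0 /= => /hf <-.
by rewrite wdegDU addrK.
Qed.

Lemma isobaricX w mu : isobaric w (wdeg w mu) 'X_[mu].
Proof. by move=> nu; rewrite mcoeffX; case: (mu =P nu) => [->|_] //; rewrite eqxx. Qed.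

Lemma belowB w k f g : below w k f -> below w k g -> below w k (f - g).
Proof.
move=> hf hg mu; rewrite mcoeffB; have [->|/hf//] := eqVneq f@_mu 0.
by rewrite sub0r oppr_eq0; apply: hg.
Qed.

Lemma belowN w k f : below w k f -> below w k (- f).
Proof. by move=> hf mu; rewrite mcoeffN oppr_eq0; apply: hf. Qed.

Lemma below_le w k l f : k <= l -> below w k f -> below w l f.
Proof. by move=> kl hf mu /hf /lt_le_trans; apply. Qed.

Lemma below_mulX w k a f : below w k f -> below w (k + w a) ('X_a * f).
Proof.
move=> hf mu; rewrite mcoeff_mulX; case: ifP => [a0 /hf|]; last by rewrite eqxx.
by rewrite -(ltrD2r (w a)) -wdegDU mnm_subK.
Qed.

Lemma below_deriv w k a f : below w k f -> below w (k - w a) f^`M(a).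
Proof.
move=> hf mu; rewrite mcoeff_deriv mulrn_eq0 /= => /hf.
by rewrite wdegDU ltrBrDr.
Qed.

Lemma below_exists w f : exists k, below w k f.
Proof.
exists (1 + \sum_(mu <- msupp f) `|wdeg w mu|) => mu; rewrite -mcoeff_msupp => hmu.
rewrite (bigD1_seq mu) ?msupp_uniq //=.
apply: le_lt_trans (ler_norm _) _; rewrite addrCA ltrDl.
by apply: ltr_pwDl => //; apply: sumr_ge0.
Qed.

End Supports.

(** * The grading and the Euler operator *)

Section Grading.
Context (K : numFieldType) (m : nat) (T : {set 'I_m}).
Local Notation A := {mpoly K[m]}.
Implicit Types (f g : A) (mu : 'X_{1..m}) (a : 'I_m).
Local Notation X := (weylX T).
Local Notation P := (weylP T).

Definition sgnT a : int := if a \in T then -1 else 1.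

Lemma gradeE mu : grade T mu = wdeg sgnT mu.
Proof.
rewrite /grade /wdeg [in RHS](bigID (mem T)) /= [RHS]addrC; congr (_ + _).
  by apply: eq_bigr => a /negPf aT; rewrite /sgnT aT mul1r.
by rewrite -sumrN; apply: eq_bigr => a aT; rewrite /sgnT aT mulN1r.
Qed.

Definition graded k f := isobaric sgnT k f.

Lemma A_gradedP k f : A_graded T k f <-> graded k f.
Proof.
split=> [[p [b [c [hb ->]]]]|hf].
  apply: isobaric_sum => i _; apply: isobaricZ.
  by have [mu <- ->] := hb i; rewrite gradeE; apply: isobaricX.
exists (size (msupp f)), (fun i => 'X_[tnth (in_tuple (msupp f)) i]).
exists (fun i => f@_(tnth (in_tuple (msupp f)) i)); split.
  move=> i; exists (tnth (in_tuple (msupp f)) i) => //.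
  by rewrite gradeE; apply: hf; rewrite -mcoeff_msupp mem_tnth.
by rewrite {1}[f]mpolyE big_tnth.
Qed.

Lemma graded_weylX k a f : graded k f -> graded (k + 1) (X a f).
Proof.
rewrite /weylX => hf; case: ifP => aT.
  have := @isobaric_deriv _ _ _ _ a _ hf; rewrite /sgnT aT opprK; exact.
have := @isobaric_mulX _ _ _ _ a _ hf; rewrite /sgnT aT; exact.
Qed.

Lemma graded_weylP k a f : graded k f -> graded (k - 1) (P a f).
Proof.
rewrite /weylP => hf; case: ifP => aT.
  have := @isobaric_mulX _ _ _ _ a _ hf; rewrite /sgnT aT => /isobaricN; exact.
have := @isobaric_deriv _ _ _ _ a _ hf; rewrite /sgnT aT; exact.
Qed.

(** Eigenvalue of X_a P_a on x^mu. On T this operator is -d_a x_a, which explains the successor. *)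
Definition weyl_ev a mu : K := if a \in T then - (mu a).+1%:R else (mu a)%:R.

Lemma mcoeff_weylXP a f mu : (X a (P a f))@_mu = weyl_ev a mu * f@_mu.
Proof.
rewrite /weylX /weylP /weyl_ev; case: (a \in T) => /=.
  rewrite mcoeff_deriv mcoeffN mcoeff_mulX mnmDE mnm1E eqxx addn1 /= addmK.
  by rewrite mulNr -[_ *+ _]mulr_natl mulrN.
rewrite mcoeff_mulX mcoeff_deriv; case: posnP => [->|a0]; first by rewrite mul0r.
by rewrite mnm_subK // mnmBE mnm1E eqxx subn1 prednK // mulr_natl.
Qed.

Lemma mcoeff_weylPX a f mu : (P a (X a f))@_mu = (weyl_ev a mu + 1) * f@_mu.
Proof. by rewrite weylPX mcoeffD mcoeff_weylXP mcoeffZ eqxx mulrDl. Qed.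

Definition euler f : A := \sum_a X a (P a f).

(** The signed exponents add up to the grade, and each index of T adds a further -1. *)
Lemma euler_graded k f : graded k f -> euler f = (k - #|T|%:Z)%:~R *: f.
Proof.
move=> hf; apply/mpolyP => mu; rewrite raddf_sum mcoeffZ /=.
under eq_bigr do rewrite mcoeff_weylXP.
rewrite -mulr_suml; have [->|/hf <-] := eqVneq f@_mu 0; first by rewrite !mulr0.
congr (_ * _); rewrite -sum1_card (big_morph Posz PoszD (erefl _)) /wdeg.
rewrite [X in _ - X]big_mkcond -sumrB (big_morph intr (intrD K) (erefl _)).
apply: eq_bigr => a _; rewrite /weyl_ev /sgnT; case: ifP => _.
  by rewrite -[in LHS]addn1 natrD opprD mulN1r intrD !rmorphN.
by rewrite mul1r subr0.
Qed.

End Grading.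

(** * The invariant Laplacian, the quadric and their sl2 relations *)

Section Laplacian.
Context (K : numFieldType) (n : nat) (T : {set 'I_(n.*2.+1)}).
Local Notation I := 'I_(n.*2.+1).
Local Notation A := {mpoly K[n.*2.+1]}.
Local Notation X := (weylX T).
Local Notation P := (weylP T).
Local Notation M := (@so_op K n T).
Implicit Types (f g : A) (a b c : I).

Definition laplacian f : A := \sum_b P (sg b) (P b f).
Definition quadric f : A := \sum_b X b (X (sg b) f).

Fact lap_is_linear : linear laplacian.
Proof.
move=> c f g; rewrite /laplacian scaler_sumr -big_split; apply: eq_bigr => b _ /=.
by rewrite !linearP.
Qed.
HB.instance Definition _ := GRing.isLinear.Build K A A _ laplacian lap_is_linear.

Fact qua_is_linear : linear quadric.
Proof.
move=> c f g; rewrite /quadric scaler_sumr -big_split; apply: eq_bigr => b _ /=.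
by rewrite !linearP.
Qed.
HB.instance Definition _ := GRing.isLinear.Build K A A _ quadric qua_is_linear.

Lemma sum_delta (F : I -> A) a : \sum_c (c == a)%:R *: F c = F a.
Proof.
rewrite (bigD1 a) //= eqxx scale1r big1 ?addr0 // => c ca.
by rewrite (negPf ca) scale0r.
Qed.

Lemma sum_delta_sg (F : I -> A) a : \sum_c (sg c == a)%:R *: F c = F (sg a).
Proof.
rewrite -[RHS](sum_delta F); apply: eq_bigr => c _.
by rewrite (can2_eq (@sgK n) (@sgK n)).
Qed.

Lemma weylP_so c a b f : P c (M a b f) =
  M a b (P c f) + ((c == a)%:R *: P b f - (c == sg b)%:R *: P (sg a) f).
Proof.
rewrite /so_op linearB /= !weylPX (weylPC _ c b) (weylPC _ c (sg a)).
by rewrite opprD addrACA.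
Qed.

(** Moving both P's past [M a b] leaves four corrections; each collapses to P_b P_{sg a} f, twice
    with each sign. *)
Lemma lap_so a b f : laplacian (M a b f) = M a b (laplacian f).
Proof.
transitivity (\sum_c (M a b (P (sg c) (P c f)) +
   ((sg c == a)%:R *: P b (P c f) - (sg c == sg b)%:R *: P (sg a) (P c f) +
   ((c == a)%:R *: P (sg c) (P b f) - (c == sg b)%:R *: P (sg c) (P (sg a) f))))).
  apply: eq_bigr => c _; rewrite weylP_so linearD /= weylP_so -addrA; congr (_ + (_ + _)).
  by rewrite linearB /= !linearZ.
rewrite big_split /= -linear_sum -[RHS]addr0; congr (_ + _).
rewrite big_split /= !sumrB !sum_delta sum_delta_sg.
rewrite (eq_bigr (fun c => (c == b)%:R *: P (sg a) (P c f))) => [|c _]; last first.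
  by rewrite (inj_eq (can_inj (@sgK n))).
by rewrite sum_delta sgK (weylPC _ b (sg a)) !addrN addr0.
Qed.

Lemma weylP_qua c f : P c (quadric f) = quadric (P c f) + 2 *: X (sg c) f.
Proof.
transitivity (\sum_b (X b (X (sg b) (P c f)) +
   ((sg b == c)%:R *: X b f + (b == c)%:R *: X (sg b) f))).
  rewrite linear_sum; apply: eq_bigr => b _ /=.
  by rewrite !weylPX linearD linearZ /= -addrA ![c == _]eq_sym.
rewrite big_split /=; congr (_ + _).
by rewrite big_split /= sum_delta sum_delta_sg scaler_nat.
Qed.

Lemma lap_qua f : laplacian (quadric f) = quadric (laplacian f) + (4 *: euler T f + n.*2.+1.*2%:R *: f).
Proof.
transitivity (\sum_c (quadric (P (sg c) (P c f)) +
   (2 *: X c (P c f) + (2 *: X (sg c) (P (sg c) f) + 2 *: f)))).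
  apply: eq_bigr => c _; rewrite weylP_qua linearD /= weylP_qua sgK linearZ /= weylPX.
  by rewrite eqxx scale1r scalerDr -addrA.
rewrite big_split /= -linear_sum; congr (_ + _).
rewrite big_split /= -scaler_sumr big_split /= -scaler_sumr.
have -> : \sum_c X (sg c) (P (sg c) f) = euler T f.
  by rewrite /euler [RHS](reindex_inj (can_inj (@sgK n))).
rewrite sumr_const card_ord -scaler_nat scalerA addrA -scalerDl -natrD.
by rewrite -natrM muln2.
Qed.

Lemma graded_qua k f : graded T k f -> graded T (k + 2) (quadric f).
Proof.
move=> hf; apply: isobaric_sum => b _.
by rewrite -[2]/(1 + 1) addrA; do 2!apply: graded_weylX.
Qed.

Lemma graded_lap k f : graded T k f -> graded T (k - 2) (laplacian f).
Proof.
move=> hf; apply: isobaric_sum => b _.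
by rewrite -[2]/(1 + 1) opprD addrA; do 2!apply: graded_weylP.
Qed.

Lemma graded_so k a b f : graded T k f -> graded T k (M a b f).
Proof.
move=> hf; rewrite /so_op; apply: isobaricD; last apply: isobaricN.
  by rewrite -(subrK 1 k); apply/graded_weylX/graded_weylP.
by rewrite -(subrK 1 k); apply/graded_weylX/graded_weylP.
Qed.

(* [laplacian] and [quadric] generate an sl2 whose weight on grade k is 2 mod 4, hence
   never 0. *)
Definition lap_qua_wt (k : int) : int := 2 * (2 * (k - #|T|%:Z) + n.*2.+1%:Z).

Lemma lap_qua_graded k f : graded T k f ->
  laplacian (quadric f) = quadric (laplacian f) + (lap_qua_wt k)%:~R *: f.
Proof.
move=> hf; rewrite lap_qua (euler_graded hf) scalerA -scalerDl; congr (_ + _ *: _).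
rewrite -[4]/(4%:~R) -[n.*2.+1.*2%:R]/(n.*2.+1.*2%:Z%:~R) -intrM -intrD /lap_qua_wt.
by congr intr; lia.
Qed.

(** The q-th application of [laplacian] meets the weight at grade k - 2q, which is [lap_qua_wt k] -
    8q. Summing over q from 0 to p gives the coefficient. *)
Lemma iter_lap_qua k p f : graded T k f ->
  iter p.+1 laplacian (quadric f) = quadric (iter p.+1 laplacian f) +
    (p.+1%:Z * (lap_qua_wt k - 4 * p%:Z))%:~R *: iter p laplacian f.
Proof.
move=> hf; have hp q : graded T (k - 2 * q%:Z) (iter q laplacian f).
  elim: q => [|q IHq] /=; first by rewrite mulr0 subr0.
  by rewrite intS (_ : k - _ = k - 2 * q%:Z - 2); [apply: graded_lap | lia].
elim: p => [|p IHp]; first by rewrite /= (lap_qua_graded hf) mulr0 subr0 mul1r.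
rewrite iterS IHp linearD linearZ.
have := lap_qua_graded (hp p.+1) => /= ->; rewrite -addrA -scalerDl.
congr (_ + _ *: _); rewrite -intrD; congr intr.
by rewrite /lap_qua_wt !intS; lia.
Qed.

Lemma lap_qua_coef_neq0 k p :
  (p.+1%:Z * (lap_qua_wt k - 4 * p%:Z))%:~R != 0 :> K.
Proof. by rewrite intr_eq0 mulf_eq0 /lap_qua_wt; lia. Qed.

End Laplacian.

(** * Bijectivity of Delta eta and the direct sum *)

Section LapQua.
Context (K : numFieldType) (n : nat) (T : {set 'I_(n.*2.+1)}).
Hypothesis sgT : forall b, b \in T -> sg b \notin T.
Local Notation I := 'I_(n.*2.+1).
Local Notation A := {mpoly K[n.*2.+1]}.
Local Notation X := (weylX T).
Local Notation P := (weylP T).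
Local Notation lap := (@laplacian K n T).
Local Notation qua := (@quadric K n T).
Implicit Types (f g : A) (a b : I).

Definition weyl_wt (w : I -> int) a : int := if a \in T then w a else - w a.

Lemma below_weylP w k a f : below w k f -> below w (k + weyl_wt w a) (P a f).
Proof.
rewrite /weylP /weyl_wt => hf; case: ifP => aT; last exact: below_deriv.
by apply/belowN/below_mulX.
Qed.

Lemma below_weylX w k a f : below w k f -> below w (k - weyl_wt w a) (X a f).
Proof.
rewrite /weylX /weyl_wt => hf; case: ifP => aT; first exact: below_deriv.
by rewrite opprK; apply: below_mulX.
Qed.

(** The weight counts the exponents outside T. Since b and sg b are never both in T, each summand of
    [lap] differentiates some variable outside T, and it multiplies only by variables of T, which
    have weight 0. *)
Lemma lap_nilpotent f : exists p, iter p lap f = 0.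
Proof.
pose w a : int := if a \in T then 0 else 1.
have lapB k g : below w k g -> below w (k - 1) (lap g).
  move=> hg; rewrite /laplacian; apply: big_ind => [mu||b _].
  - by rewrite mcoeff0 eqxx.
  - by move=> u v hu hv; rewrite -[v]opprK; apply: belowB => //; apply: belowN.
  apply: (below_le _ (below_weylP (a:=sg b) (below_weylP (a:=b) hg))).
  rewrite /weyl_wt /w; case: (boolP (b \in T)) => [/sgT/negPf->|_]; first by lia.
  by case: (sg b \in T); lia.
have wp mu : 0 <= wdeg w mu by apply: sumr_ge0 => a _; rewrite /w; case: ifP; lia.
have [k hk] := below_exists w f.
exists `|k|%N; have : below w `|k|%N f by apply: below_le hk; lia.
elim: `|k|%N f {hk} => [|p IHp] f hf.
  apply/mpolyP => mu; rewrite mcoeff0; apply: contraTeq isT => /hf.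
  by rewrite ltNge wp.
by rewrite iterSr; apply: IHp; have := lapB _ _ hf; rewrite intS addrC addKr.
Qed.

Lemma iter_lap_lin p c f g : iter p lap (c *: f + g) = c *: iter p lap f + iter p lap g.
Proof. by elim: p => //= p ->; rewrite linearP. Qed.

(** When lap (qua f) = 0, [iter_lap_qua] turns lap^(p+1) f = 0 into lap^p f = 0, so the nilpotency
    order descends to 0. *)
Lemma lap_qua_inj k f : graded T k f -> lap (qua f) = 0 -> f = 0.
Proof.
move=> hf lq0; have iter0 p : iter p lap 0 = 0 by elim: p => //= p ->; rewrite linear0.
have [p] := lap_nilpotent f; elim: p => // p IHp fp0; apply: IHp.
have := iter_lap_qua p hf; rewrite iterSr lq0 iter0 fp0 linear0 add0r => /esym/eqP.
by rewrite scaler_eq0 (negPf (lap_qua_coef_neq0 _ _ _ _)) => /eqP.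
Qed.

Lemma lap_qua_surj k f : graded T k f -> exists2 g, graded T k g & lap (qua g) = f.
Proof.
move=> hf; have [p] := lap_nilpotent f; elim: p f hf => [|p IHp] f hf.
  by move=> /= ->; exists 0; [apply: isobaric0 | rewrite !linear0].
move=> fp0; have cn0 := lap_qua_coef_neq0 K T k p.
move: (iter_lap_qua p hf) cn0; set c := (_%:~R); rewrite iterSr fp0 linear0 add0r => E cn0.
have hlq : graded T k (lap (qua f)).
  by rewrite -(addrK 2 k); apply/graded_lap/graded_qua.
(* E says that lap^p (lap (qua f)) = c lap^p f, so this combination is killed by lap^p. *)
have [||g hg Eg] := IHp (- c^-1 *: lap (qua f) + f).
- exact: isobaric_lin.
- by rewrite iter_lap_lin E scalerA mulNr mulVf // scaleN1r addNr.
exists (c^-1 *: f + g); first exact: isobaric_lin.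
by rewrite linearP /= linearP /= Eg addrA -scalerDl subrr scale0r add0r.
Qed.

Lemma graded_direct_sum k :
  is_direct_sum (graded T k) (fun f => graded T k f /\ lap f = 0)
    (image_of qua (graded T (k - 2))).
Proof.
split=> [f|f [_ lf0] [g hg E]]; last first.
  by rewrite E in lf0 *; rewrite (lap_qua_inj hg lf0) linear0.
split=> [hf|[u [v [[hu _] [g hg ->] ->]]]]; last first.
  apply: isobaricD => //; have := graded_qua hg; rewrite subrK; exact.
(* The component in the image of [qua] is forced: it must have the same Laplacian as f. *)
have [g hg Eg] := lap_qua_surj (graded_lap hf).
exists (f - qua g), (qua g); split; last by rewrite subrK.
- split; last by rewrite linearB /= Eg subrr.
  apply: isobaricD => //; apply: isobaricN.
  by have := graded_qua hg; rewrite subrK; exact.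
- by exists g.
Qed.

End LapQua.

(** * Identification of Delta and eta, and the harmonic submodule *)

Section Operators.
Context (K : numFieldType) (n s : nat).
Hypothesis sn : (s < n)%N.
Local Notation T := (Tset n s).
Local Notation A := {mpoly K[n.*2.+1]}.

Lemma idx_lo_Tset i : (1 <= i <= n)%N -> (idx n i.+1 \in T) = (i <= s)%N.
Proof. by move=> ?; rewrite idx_Tset; lia. Qed.

Lemma idx_hi_Tset i : (1 <= i <= n)%N -> (idx n (n + i.+1) \in T) = false.
Proof. by move=> ?; rewrite idx_Tset; lia. Qed.

Lemma idx1_Tset : (idx n 1 \in T) = false.
Proof. by rewrite idx_Tset; lia. Qed.

Lemma sg_Tset b : b \in T -> sg b \notin T.
Proof. by rewrite !inE val_sg; do 2?case: ifP => ?; lia. Qed.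

(** The sum over b meets each pair {b, sg b} twice, which is the factor 2; the minus sign comes from
    P_b = -x_b on T. *)
Lemma Delta_opE (f : A) : @Delta_op K n s f = laplacian T f.
Proof.
rewrite /Delta_op /laplacian big_idx sg_idx1 /weylP !idx1_Tset -addrA; congr (_ + _).
rewrite [RHS](@big_cat_nat _ _ _ s.+1) /=; [|lia|lia].
congr (_ + _); rewrite ?scaler_sumr -?sumrN; apply: eq_big_nat => i hi.
  rewrite (@sg_idx_lo n i) ?(@sg_idx_hi n i); [|lia|lia].
  rewrite (@idx_lo_Tset i); last by lia.
  rewrite (@idx_hi_Tset i); last by lia.
  rewrite (_ : i <= s)%N; last by lia.
  rewrite mderivN mderiv_mulX eq_idx; [|lia|lia].
  by rewrite (_ : (_ == _) = false) ?scale0r ?addr0 -?opprD ?scaler_nat //; lia.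
rewrite (@sg_idx_lo n i) ?(@sg_idx_hi n i); [|lia|lia].
rewrite (@idx_lo_Tset i) ?(@idx_hi_Tset i); [|lia|lia].
by rewrite (_ : (i <= s)%N = false) ?scaler_nat ?mulr2n 1?mderiv_comm //; lia.
Qed.

Lemma eta_opE (f : A) : @eta_op K n s f = quadric T f.
Proof.
rewrite /eta_op /quadric big_idx sg_idx1 /weylX !idx1_Tset -addrA; congr (_ + _).
  by rewrite expr2 mulrA.
rewrite [RHS](@big_cat_nat _ _ _ s.+1) /=; [|lia|lia].
congr (_ + _); rewrite ?scaler_sumr -?sumrN; apply: eq_big_nat => i hi.
  rewrite (@sg_idx_lo n i) ?(@sg_idx_hi n i); [|lia|lia].
  rewrite (@idx_lo_Tset i); last by lia.
  rewrite (@idx_hi_Tset i); last by lia.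
  rewrite (_ : i <= s)%N; last by lia.
  rewrite mderiv_mulX eq_idx; [|lia|lia].
  by rewrite (_ : (_ == _) = false) ?scale0r ?addr0 ?scaler_nat //; lia.
rewrite (@sg_idx_lo n i) ?(@sg_idx_hi n i); [|lia|lia].
rewrite (@idx_lo_Tset i) ?(@idx_hi_Tset i); [|lia|lia].
rewrite (_ : (i <= s)%N = false) ?scaler_nat ?mulr2n; last by lia.
by rewrite -mulrA [X in _ = _ + X]mulrCA.
Qed.

Definition harmonic k (f : A) := graded T k f /\ laplacian T f = 0.

Lemma H_gradedP k (f : A) : @H_graded K n s k f <-> harmonic k f.
Proof.
by rewrite /H_graded Delta_opE; split=> -[hf ?]; split=> //; apply/A_gradedP.
Qed.

Lemma A_graded_direct_sum k :
  is_direct_sum (A_graded T k) (@H_graded K n s k)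
    (image_of (@eta_op K n s) (A_graded T (k - 2))).
Proof.
have [d1 d2] := @graded_direct_sum K n T sg_Tset k.
have im f : image_of (@eta_op K n s) (A_graded T (k - 2)) f <->
            image_of (@quadric K n T) (graded T (k - 2)) f.
  by split=> -[g /A_gradedP hg ->]; exists g; rewrite ?eta_opE.
split=> [f|f /H_gradedP hf /im]; last exact: d2.
split=> [/A_gradedP/d1[u [v [hu hv ->]]]|[u [v [hu hv ->]]]].
  by exists u, v; split=> //; [apply/H_gradedP | apply/im].
by apply/A_gradedP/d1; exists u, v; split=> //; [apply/H_gradedP | apply/im].
Qed.

Lemma harmonic_subspace k : is_subspace (harmonic k).
Proof.
split; first by split; [apply: isobaric0 | rewrite linear0].
move=> c f g [hf lf] [hg lg]; split; first exact: isobaric_lin.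
by rewrite linearP /= lf lg scaler0 addr0.
Qed.

Lemma harmonic_submodule k : so_submodule T (harmonic k).
Proof.
apply/so_submoduleP; split; first exact: harmonic_subspace.
by move=> a b f [hf lf]; split; [apply: graded_so | rewrite lap_so lf linear0].
Qed.

End Operators.

(** * Vectors killed by the height-lowering operators *)

Section HighestVector.
Context (K : numFieldType) (n s : nat).
Hypotheses (s1 : (1 <= s)%N) (sn : (s < n)%N).
Local Notation T := (Tset n s).
Local Notation I := 'I_(n.*2.+1).
Local Notation A := {mpoly K[n.*2.+1]}.
Local Notation X := (weylX T).
Local Notation P := (weylP T).
Local Notation M := (@so_op K n T).
Local Notation lap := (@laplacian K n T).
Local Notation p := (idx n s.+2).
Local Notation q := (idx n (n + s.+2)).
Local Notation l := (idx n s.+1).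
Local Notation o := (idx n 1).
Implicit Types (f g : A) (a b : I) (mu : 'X_{1..n.*2.+1}).

(* The action of [so_op a b] with [ht b < ht a] lowers the degree with weights [htw]. *)
Definition ht a : int :=
  if a \in T then (if a == l then 1 else 2)
  else if sg a \in T then (if sg a == l then -3 else -4)
  else if a == p then 0 else if a == q then -2 else -1.
Definition htw a : int := if a \in T then ht a else - ht a.

Lemma sg_p : sg p = q. Proof. by rewrite sg_idx_lo //; lia. Qed.
Lemma p_mid : (p \in T) = false. Proof. by rewrite idx_Tset; lia. Qed.
Lemma q_mid : (q \in T) = false. Proof. by rewrite idx_Tset; lia. Qed.
Lemma o_mid : (o \in T) = false. Proof. by rewrite idx_Tset; lia. Qed.
Lemma l_T : l \in T. Proof. by rewrite idx_Tset; lia. Qed.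

(** This makes both terms of [so_op a b] shift the degree by the same amount. The symmetry is about
    -1 and not 0 so that [htw] is nonnegative on every variable; a common shift of [ht] changes the
    degree only by a multiple of the grade. *)
Lemma ht_sg a : ht (sg a) = - 2 - ht a.
Proof.
rewrite /ht sgK; case: (boolP (a \in T)) => [/[dup] aT /(sg_Tset sn)/negPf->|aT].
  by case: (a == l).
case: (sg a \in T); first by case: (sg a == l).
rewrite !(can2_eq (@sgK n) (@sgK n)) sg_p -{2}sg_p sgK.
have pq : (p == q) = false by rewrite eq_idx; lia.
by case: (eqVneq a p) => [->|_]; rewrite ?pq //; case: (a == q).
Qed.

Lemma weyl_wt_htw a : weyl_wt T htw a = ht a.
Proof. by rewrite /weyl_wt /htw; case: (a \in T); rewrite ?opprK. Qed.

Lemma htw_ge0 a : 0 <= htw a.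
Proof. rewrite /htw /ht; case: (a \in T); first by case: (a == l).
by case: (sg a \in T); [case: (sg a == l) | case: (a == p); [|case: (a == q)]]. Qed.

Lemma below_so_op k a b f : ht b < ht a -> below htw k f -> below htw (k - 1) (M a b f).
Proof.
move=> ba hf; rewrite /so_op; apply: belowB.
  apply: (below_le _ (below_weylX (a:=a) (below_weylP (T:=T) (a:=b) hf))).
  by rewrite !weyl_wt_htw; lia.
apply: (below_le _ (below_weylX (a:=sg b) (below_weylP (T:=T) (a:=sg a) hf))).
by rewrite !weyl_wt_htw !ht_sg; lia.
Qed.

Lemma killed_vector (U : A -> Prop) f : so_submodule T U -> U f -> f != 0 ->
  exists g, [/\ U g, g != 0 & forall a b, ht b < ht a -> M a b g = 0].
Proof.
move=> /so_submoduleP[_ UM] Uf f0; have [k hk] := below_exists htw f.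
have {hk} : below htw `|k|%N f by apply: below_le hk; lia.
elim: `|k|%N f Uf f0 => [|d IHd] f Uf f0 hf.
  case/negP: f0; apply/eqP/mpolyP => mu; rewrite mcoeff0; apply: contraTeq isT => /hf.
  by rewrite ltNge sumr_ge0 // => a _; rewrite mulr_ge0 ?htw_ge0.
case: (boolP [exists a, exists b, (ht b < ht a) && (M a b f != 0)]).
  case/existsP => a /existsP[b /andP[ba Mf0]]; apply: (IHd (M a b f)) => //.
    exact: UM.
  by have := below_so_op ba hf; rewrite intS addrC addKr.
rewrite negb_exists => /forallP killed; exists f; split=> // a b ba.
have := killed a; rewrite negb_exists => /forallP/(_ b).
by rewrite ba negbK => /eqP.
Qed.

Lemma lap_weylX a f : lap (X a f) = X a (lap f) + 2 *: P (sg a) f.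
Proof.
transitivity (\sum_c (X a (P (sg c) (P c f)) +
   ((sg c == a)%:R *: P c f + (c == a)%:R *: P (sg c) f))).
  apply: eq_bigr => c _; rewrite weylPX linearD /= weylPX linearZ /=.
  by rewrite -addrA; congr (_ + (_ + _)); case: eqP => [->|_]; rewrite ?scale0r ?sgK.
rewrite big_split /= -linear_sum; congr (_ + _).
by rewrite big_split /= sum_delta sum_delta_sg scaler_nat.
Qed.

(** Put g = P_{sg a} f, so that lap (X_a f) = 2 g. For b in C, the equation M a b f = 0 reads P_b
    X_a f = X_{sg b} g, hence P_{sg b} P_b X_a f = P_c X_c g with c = sg b. If b is not in C, then
    sg b is, and the same holds with c = b. Comparing coefficients at mu gives the identity. *)
Lemma killed_eigen (C : pred I) a f : lap f = 0 ->
  (forall b, C b -> b != a /\ M a b f = 0) -> (forall b, ~~ C b -> C (sg b)) ->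
  forall mu, (P (sg a) f)@_mu != 0 ->
  \sum_b (weyl_ev K T (if C b then sg b else b) mu + 1) = 2.
Proof.
move=> lf0 hC hN mu gmu; set g := P (sg a) f.
have PXg b : C b -> P b (X a f) = X (sg b) g.
  move=> /hC[ba /eqP]; rewrite weylPX (negPf ba) scale0r addr0 subr_eq0.
  by move/eqP.
have E : \sum_b P (if C b then sg b else b) (X (if C b then sg b else b) g) = 2 *: g.
  have -> : 2 *: g = lap (X a f) by rewrite lap_weylX lf0 linear0 add0r.
  apply: eq_bigr => b _.
  case: ifP => [/PXg->//|/negbT/hN Csb]; rewrite weylPC PXg ?sgK //.
apply: (mulIf gmu); rewrite mulr_suml.
have := congr1 (mcoeff mu) E; rewrite raddf_sum mcoeffZ /= => <-.
by apply: eq_bigr => b _; rewrite mcoeff_weylPX.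
Qed.

Lemma mderiv_eq0_supp a f mu : f^`M(a) = 0 -> f@_mu != 0 -> mu a = 0%N.
Proof.
move=> da fmu; case: (posnP (mu a)) => // a0; case/negP: fmu.
have := congr1 (mcoeff (mu - U_(a))%MM) da.
by rewrite mcoeff_deriv mcoeff0 mnm_subK // => /eqP; rewrite mulrn_eq0.
Qed.

Lemma weylP_deriv a f : a \notin T -> P a f = f^`M(a).
Proof. by rewrite /weylP => /negPf->. Qed.

Lemma weylX_deriv a f : a \in T -> X a f = f^`M(a).
Proof. by rewrite /weylX => ->. Qed.

Section Killed.
Variables (k : int) (f : A).
Hypotheses (fk : graded T k f) (lf0 : lap f = 0).
Hypothesis killed : forall a b, ht b < ht a -> M a b f = 0.

Lemma ht_T a : a \in T -> 0 < ht a.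
Proof. by rewrite /ht => ->; case: ifP. Qed.

Lemma ht_notT a : a \notin T -> ht a <= 0.
Proof. by rewrite /ht => /negPf->; case: (sg a \in T); [case: (sg a == l) | case: (a == p); [|case: (a == q)]]. Qed.

(** Parity in [killed_eigen], with C the complement of T. A pair {lo, hi} meeting T contributes -2
    mu(lo). Any other pair contributes mu(lo) + mu(hi) + 2, which is even because the two exponents
    agree. The fixed index contributes mu(o) + 1, which is odd. The total cannot be 2. *)
Lemma killed_P_sg i : i \in T -> P (sg i) f = 0.
Proof.
move=> iT; set g := P (sg i) f.
have Mi b : b \notin T -> b != i /\ M i b f = 0.
  move=> bT; split; first by apply: contraNneq bT => ->.
  by apply: killed; apply: le_lt_trans (ht_notT bT) (ht_T iT).
have PXg b : b \notin T -> P b (X i f) = X (sg b) g.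
  move=> /Mi[bi /eqP]; rewrite weylPX (negPf bi) scale0r addr0 subr_eq0.
  by move/eqP.
(* Both sides are P_b P_c (X_i f). *)
have PX2 b c : b \notin T -> c \notin T -> P c (X (sg b) g) = P b (X (sg c) g).
  by move=> bT cT; rewrite -!PXg // weylPC.
(* Take c = sg b in PX2: the two sides are then diagonal operators applied to g. *)
have sym mu b : b \notin T -> sg b \notin T -> g@_mu != 0 -> mu b = mu (sg b).
  move=> bT sbT gmu; have := congr1 (mcoeff mu) (PX2 _ _ bT sbT).
  rewrite sgK !mcoeff_weylPX => /(mulIf gmu)/addIr.
  by rewrite /weyl_ev (negPf bT) (negPf sbT) => /eqP; rewrite eqr_nat => /eqP.
have oe mu : odd (mu o) -> g@_mu = 0.
  have op : (o == p) = false by rewrite eq_idx; lia.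
  have oq : (o == q) = false by rewrite eq_idx; lia.
  have E : 'X_o * g^`M(p) = 'X_q * g^`M(o).
    have := PX2 o p; rewrite sg_idx1 sg_p o_mid p_mid => /(_ isT isT).
    rewrite !weylPX /weylP /weylX o_mid p_mid q_mid (eq_sym p) op oq.
    by rewrite !scale0r !addr0.
  elim: {mu}(mu o) {-2}mu (leqnn (mu o)) => [|d IHd] mu; first by case: (mu o).
  move=> mud muo; have mu0 : (0 < mu o)%N by case: (mu o) muo.
  (* At this monomial the right side of E is mu(o) times the coefficient of g at mu. The left side
     is a multiple of a coefficient whose exponent of x_1 is smaller by 2, or is 0 when mu(o) =
     1. *)
  have := congr1 (mcoeff (mu - U_(o) + U_(q))%MM) E.
  rewrite !mcoeff_mulX !mcoeff_deriv addmK mnm_subK // !mnmDE !mnmBE !mnm1E eqxx.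
  rewrite ![_ == o]eq_sym op oq !eqxx /= subn0 !addn1 /=.
  set z := (X in X = _); have -> : z = 0.
    rewrite /z; case: ifP => // mu1; rewrite IHd ?mul0rn // !(mnmDE, mnmBE, mnm1E) !eqxx;
      by rewrite ![_ == o]eq_sym op oq; lia.
  by move/esym/eqP; rewrite mulrn_eq0 => /eqP.
apply/eqP/negPn/negP => g0.
have [mu gmu] : exists mu, g@_mu != 0.
  have: msupp g != [::] by rewrite msupp_eq0.
  by case E: (msupp g) => [//|mu r] _; exists mu; rewrite -mcoeff_msupp E mem_head.
have hC b : ~~ (b \notin T) -> sg b \notin T by rewrite negbK; apply: (sg_Tset sn).
have := killed_eigen (C:=fun b => b \notin T) lf0 Mi hC gmu.
rewrite big_idx /= o_mid /= sg_idx1 /weyl_ev o_mid.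
have /negPf oF: ~~ odd (mu o) by apply: contraNN gmu => /oe ->.
rewrite -(odd_double_half (mu o)) oF add0n => H.
have [z Ez] : exists z : int, \sum_(1 <= i0 < n.+1)
   (weyl_ev K T (if idx n i0.+1 \notin T then sg (idx n i0.+1) else idx n i0.+1) mu + 1 +
    (weyl_ev K T (if idx n (n + i0.+1) \notin T then sg (idx n (n + i0.+1))
       else idx n (n + i0.+1)) mu + 1)) = (2 * z)%:~R.
  rewrite big_nat; apply: (big_ind (fun x : K => exists z : int, x = (2 * z)%:~R)).
  - by exists 0.
  - by move=> x y [u ->] [v ->]; exists (u + v); rewrite mulrDr intrD.
  move=> j hj; rewrite (@idx_lo_Tset n s sn j) ?(@idx_hi_Tset n s sn j); [|lia|lia].
  rewrite (@sg_idx_lo n j) ?(@sg_idx_hi n j); [|lia|lia].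
  have loT := @idx_lo_Tset n s sn j; have hiT := @idx_hi_Tset n s sn j.
  case: (leqP j s) => js /=; rewrite /weyl_ev ?loT ?hiT ?js; try lia.
    exists (- (mu (idx n j.+1))%:Z).
    rewrite -[in LHS]addn1 natrD opprD addrNK mulrN mulr_natl mulr2n opprD intrD.
    by rewrite !rmorphN.
  have := sym mu (idx n j.+1); rewrite (@sg_idx_lo n j) ?loT ?hiT; try lia.
  rewrite -ltnNge js => /(_ isT isT gmu) <-; rewrite leqNgt js /=.
  exists ((mu (idx n j.+1))%:Z + 1).
  by rewrite mulr_natl mulr2n !intrD.
move: H; rewrite Ez -[2 in RHS]/(2%:~R) -[1]/(1%:~R) -[(mu o)./2.*2%:R]/((mu o)./2.*2%:Z%:~R).
by rewrite -!intrD => /eqP; rewrite eqr_int; lia.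
Qed.

End Killed.
End HighestVector.

(** * A killed harmonic vector is a multiple of the singular monomial *)

Section KilledVector.
Context (K : numFieldType) (n s : nat).
Hypotheses (s1 : (1 <= s)%N) (sn : (s < n)%N).
Local Notation T := (Tset n s).
Local Notation I := 'I_(n.*2.+1).
Local Notation A := {mpoly K[n.*2.+1]}.
Local Notation X := (weylX T).
Local Notation P := (weylP T).
Local Notation M := (@so_op K n T).
Local Notation lap := (@laplacian K n T).
Local Notation p := (idx n s.+2).
Local Notation q := (idx n (n + s.+2)).
Local Notation l := (idx n s.+1).
Local Notation o := (idx n 1).
Implicit Types (a b : I) (mu : 'X_{1..n.*2.+1}).

Definition hvar (k : int) : I := if 0 <= k then p else l.
Definition hmon (k : int) : 'X_{1..n.*2.+1} := (U_(hvar k) *+ `|k|)%MM.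

Lemma mpolyX_neq0 mu : 'X_[mu] != 0 :> A.
Proof. by rewrite -msupp_eq0 msuppX. Qed.

Lemma monomial_supp (f : A) (mu0 : 'X_{1..n.*2.+1}) :
  (forall mu, f@_mu != 0 -> mu = mu0) -> f = f@_mu0 *: 'X_[mu0].
Proof.
move=> hf; apply/mpolyP => mu; rewrite mcoeffZ mcoeffX.
case: eqP => [<-|ne]; first by rewrite mulr1.
by rewrite mulr0; apply/eqP/negPn/negP => /hf E; apply: ne.
Qed.

Lemma mderiv2_eq0_supp a b (f : A) mu : a != b -> f^`M(a)^`M(b) = 0 -> f@_mu != 0 ->
  (0 < mu a)%N -> mu b = 0%N.
Proof.
move=> ab dab fmu a0; have : (mu - U_(a))%MM b = 0%N; last first.
  by rewrite mnmBE mnm1E (negPf ab) subn0.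
by apply: mderiv_eq0_supp dab _; rewrite mcoeff_deriv mnm_subK // mulrn_eq0.
Qed.

Lemma wdeg_le0 (w : I -> int) mu : (forall a, (0 < mu a)%N -> w a <= 0) -> wdeg w mu <= 0.
Proof.
move=> hw; rewrite -oppr_ge0 /wdeg -sumrN; apply: sumr_ge0 => a _.
by case: (posnP (mu a)) => [->|/hw]; [rewrite mulr0 | rewrite -mulNr; nia].
Qed.

Lemma wdeg_hvar (w : I -> int) mu c : (forall a, a != c -> mu a = 0%N) ->
  wdeg w mu = w c * (mu c)%:Z.
Proof.
by move=> h; rewrite /wdeg (bigD1 c) //= big1 ?addr0 // => a /h ->; rewrite mulr0.
Qed.

Variables (k : int) (f : A).
Hypotheses (fk : graded T k f) (lf0 : lap f = 0).
Hypothesis killed : forall a b, ht s b < ht s a -> M a b f = 0.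

Lemma killed_supp_sg mu i : f@_mu != 0 -> i \in T -> mu (sg i) = 0%N.
Proof.
move=> fmu iT; apply: mderiv_eq0_supp fmu.
by rewrite -(weylP_deriv _ (sg_Tset sn iT)); apply: killed_P_sg.
Qed.

(** X_i P_b f equals M i b f + X_{sg b} P_{sg i} f, and both terms vanish. So no monomial of f mixes
    a variable of T with one outside T, and the sign of k decides which kind occurs. *)
Lemma killed_mderiv2 i b : i \in T -> b \notin T -> f^`M(b)^`M(i) = 0.
Proof.
move=> iT bT; rewrite -(weylP_deriv _ bT) -(weylX_deriv _ iT).
have : M i b f = 0 by apply: killed; apply: le_lt_trans (ht_notT bT) (ht_T iT).
by rewrite /so_op (killed_P_sg s1 sn lf0 killed) // linear0 subr0.
Qed.

Lemma killed_supp_T mu i : 0 <= k -> f@_mu != 0 -> i \in T -> mu i = 0%N.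
Proof.
move=> k0 fmu iT; case: (posnP (mu i)) => // i0.
have bT b : b \notin T -> mu b = 0%N.
  move=> bT; apply: (@mderiv2_eq0_supp i b f) => //; first by apply: contraNneq bT => <-.
  by rewrite mderiv_comm; apply: killed_mderiv2.
have := fk fmu; rewrite /wdeg (bigD1 i) //= /sgnT iT => E.
have : wdeg (fun a => if a == i then 0 else sgnT T a) mu <= 0.
  apply: wdeg_le0 => a; case: eqP => // _; rewrite /sgnT; case: ifP => // /negbT/bT ->//.
rewrite /wdeg (bigD1 i) //= eqxx mul0r add0r.
rewrite (eq_bigr (fun a => sgnT T a * (mu a)%:Z)) => [|a /negPf->//].
by move: E; rewrite /sgnT; set S := (X in _ + X = _) => E; rewrite -/S => S0; move: E S0 k0 i0; clearbody S; clear; lia.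
Qed.

Lemma killed_supp_notT mu b : k < 0 -> f@_mu != 0 -> b \notin T -> mu b = 0%N.
Proof.
move=> k0 fmu bT; case: (posnP (mu b)) => // b0.
have iT i : i \in T -> mu i = 0%N.
  move=> iT; apply: (@mderiv2_eq0_supp b i f) => //; first by apply: contraNneq bT => ->.
  exact: killed_mderiv2.
suff : 0 <= k by rewrite leNgt k0.
rewrite -(fk fmu); apply: sumr_ge0 => a _; rewrite /sgnT.
by case: ifP => [/iT->|_]; rewrite ?mulr0 ?mul1r.
Qed.

(** Positivity in [killed_eigen] at a = p. The exponents on T vanish, so no summand is negative,
    while those at o, p and q are each at least 1: their sum already exceeds 2. *)
Lemma killed_P_q : 0 <= k -> P q f = 0.
Proof.
move=> k0; have qp : sg q = p by rewrite -(sg_p sn) sgK.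
pose C b := (b \notin T) && (b != p).
have hC b : C b -> b != p /\ M p b f = 0.
  case/andP => bT bp; split=> //.
  have [sT|sT] := boolP (sg b \in T).
    rewrite /so_op -[b](sgK b) (killed_P_sg s1 sn lf0 killed) // linear0 sub0r sgK.
    rewrite weylX_deriv // weylP_deriv ?(sg_p sn) ?(q_mid s1 sn) // .
    apply/eqP; rewrite oppr_eq0; apply/eqP/mpolyP => mu; rewrite mcoeff0 mcoeff_deriv.
    apply/eqP; rewrite mulrn_eq0 /= mcoeff_deriv mulrn_eq0 /=.
    apply: contraTT isT => /(killed_supp_T k0)/(_ sT).
    by rewrite !mnmDE !mnm1E eqxx; lia.
  have [->|bq] := eqVneq b q; first by rewrite /so_op qp (sg_p sn) subrr.
  by apply: killed; rewrite /ht (negPf bT) (negPf sT) (negPf bp) (negPf bq) (p_mid s1 sn)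
    (sg_p sn) (q_mid s1 sn) eqxx.
have hN b : ~~ C b -> C (sg b).
  rewrite /C negb_and !negbK => /orP[bT|/eqP->].
    rewrite (sg_Tset sn bT) /=; apply: contraTneq bT => E.
    by rewrite -[b]sgK E (sg_p sn) (q_mid s1 sn).
  by rewrite (sg_p sn) (q_mid s1 sn) eq_idx; lia.
apply/eqP/negPn/negP => h0.
have [mu hmu] : exists mu, (P q f)@_mu != 0.
  have: msupp (P q f) != [::] by rewrite msupp_eq0.
  by case E: (msupp (P q f)) => [//|mu r] _; exists mu; rewrite -mcoeff_msupp E mem_head.
have muT i : i \in T -> mu i = 0%N.
  move=> iT; move: hmu; rewrite weylP_deriv ?(q_mid s1 sn) // mcoeff_deriv mulrn_eq0 /=.
  by move=> /(killed_supp_T k0)/(_ iT); rewrite mnmDE; lia.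
rewrite -(sg_p sn) in hmu; have := killed_eigen lf0 hC hN hmu.
have opq : [&& o != p, o != q & p != q] by rewrite !eq_idx; lia.
have ev0 b : 0 <= weyl_ev K T (if C b then sg b else b) mu + 1.
  by rewrite /weyl_ev; case: ifP => [/muT->|_]; rewrite ?addNr // addr_ge0.
have ev1 b : b \in [:: o; p; q] -> 1 <= weyl_ev K T (if C b then sg b else b) mu + 1.
  move=> hb; rewrite /weyl_ev ifN ?lerDr //; move: hb.
  rewrite !in_cons in_nil orbF => /or3P[]/eqP->; rewrite /C ?(o_mid s1 sn) ?(p_mid s1 sn) ?(q_mid s1 sn).
  - by case: ifP; rewrite ?sg_idx1 (o_mid s1 sn).
  - by rewrite eqxx (p_mid s1 sn).
  - by case: ifP; rewrite ?qp ?(p_mid s1 sn) ?(q_mid s1 sn).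
move=> E; have : (3 : K) <= 2; last by rewrite ler_nat.
rewrite -[2 in X in _ <= X]E (bigD1 o) //= (bigD1 p) /=; last by case/and3P: opq => ? ? ?; rewrite eq_sym.
rewrite (bigD1 q) /=; last by case/and3P: opq => ? ? ?; rewrite ![q == _]eq_sym; apply/andP.
rewrite [3](_ : _ = 1 + (1 + (1 + 0))); last by rewrite addr0 -[1]/(1%:R) -!natrD.
by do 3![apply: lerD; first by apply: ev1; rewrite !inE eqxx ?orbT]; apply: sumr_ge0.
Qed.

(** The variables still to be excluded are handled by M p a f = 0 when k >= 0, and by M a l f = 0
    when k < 0. Their second terms vanish, leaving x_p d_a f = 0 and x_l d_a f = 0. The grade then
    fixes the exponent of the one remaining variable. *)
Lemma killed_hmon : f = f@_(hmon k) *: 'X_[hmon k].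
Proof.
apply: monomial_supp => mu fmu.
have supp a : a != hvar k -> mu a = 0%N.
  rewrite /hvar; case: (lerP 0 k) => k0 ac.
    have [aT|aT] := boolP (a \in T); first exact: killed_supp_T aT.
    have [sT|sT] := boolP (sg a \in T); first by rewrite -[a]sgK; apply: killed_supp_sg.
    apply: mderiv_eq0_supp fmu; rewrite -(weylP_deriv _ aT).
    have [->|aq] := eqVneq a q; first exact: killed_P_q.
    have : M p a f = 0.
      apply: killed; rewrite /ht (negPf aT) (negPf sT) (negPf ac) (negPf aq) (p_mid s1 sn).
      by rewrite (sg_p sn) (q_mid s1 sn) eqxx.
    rewrite /so_op (sg_p sn) killed_P_q // linear0 subr0 /weylX (p_mid s1 sn) => /eqP.
    by rewrite mulf_eq0 (negPf (mpolyX_neq0 _)) => /eqP.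
  have [aT|aT] := boolP (a \in T); last exact: killed_supp_notT aT.
  apply: mderiv_eq0_supp fmu; rewrite -(weylX_deriv _ aT).
  have lT := l_T s1 sn.
  have : M a l f = 0 by apply: killed; rewrite /ht aT lT eqxx (negPf ac).
  rewrite /so_op (killed_P_sg s1 sn lf0 killed) // linear0 subr0.
  have := weylPX T l a f; rewrite eq_sym (negPf ac) scale0r addr0 => <- /eqP.
  by rewrite /weylP lT oppr_eq0 mulf_eq0 (negPf (mpolyX_neq0 _)) => /eqP.
have := fk fmu; rewrite (wdeg_hvar _ supp) => E.
apply/mnmP => a; rewrite /hmon mulmnE mnm1E.
have [->|ac] := eqVneq a (hvar k); last by rewrite mul0n supp.
rewrite mul1n; move: E; rewrite /sgnT /hvar.
case: (lerP 0 k) => k0; rewrite ?(p_mid s1 sn) ?(l_T s1 sn); lia.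
Qed.

End KilledVector.

Section ContainsHmon.
Context (K : numFieldType) (n s : nat).
Hypotheses (s1 : (1 <= s)%N) (sn : (s < n)%N).
Local Notation T := (Tset n s).
Local Notation A := {mpoly K[n.*2.+1]}.

Lemma submodule_hmon k (U : A -> Prop) f : so_submodule T U ->
  (forall g, U g -> harmonic s k g) -> U f -> f != 0 -> U 'X_[hmon n s k].
Proof.
move=> subU UH Uf f0; have [g [Ug g0 killed]] := killed_vector s1 sn subU Uf f0.
have [gk lg0] := UH _ Ug; have E := killed_hmon s1 sn gk lg0 killed.
have c0 : g@_(hmon n s k) != 0 by apply: contraNneq g0 => c0; rewrite E c0 scale0r.
case: subU => -[U0 UD] _; have := UD (g@_(hmon n s k))^-1 g 0 Ug U0.
by rewrite addr0 {2}E scalerA mulVf // scale1r.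
Qed.

End ContainsHmon.

(** * Separating a vector from a subspace in finite dimension *)

Section Separation.
Context (K : fieldType) (N : nat).

(** A subspace is only a predicate here, so its matrix is grown by one vector of V at a time, chosen
    classically; d bounds the rank still missing. *)
Lemma subspace_mx (V : 'rV[K]_N -> Prop) : is_subspace V ->
  exists A : 'M[K]_N, forall u, V u <-> (u <= A)%MS.
Proof.
move=> [V0 VD].
suff grow d (A : 'M[K]_N) : (N - \rank A <= d)%N -> (forall u : 'rV_N, (u <= A)%MS -> V u) ->
    exists B : 'M[K]_N, forall u, V u <-> (u <= B)%MS.
  by apply: (grow _ 0 (leqnn _)) => u; rewrite submx0 => /eqP ->.
elim: d A => [|d IHd] A rA AV.
  exists A => u; split=> [_|/AV//]; apply: submx_full; rewrite /row_full.
  by have := rank_leq_row A; lia.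
have [[u [Vu uA]]|all] := boolp.EM (exists u, V u /\ ~~ (u <= A)%MS); last first.
  exists A => u; split=> [Vu|/AV//]; apply: contraPT Vu => uA Vu.
  by apply: all; exists u.
apply: (IHd (A + u)%MS) => [|v /sub_addsmxP[[D c] ->] /=].
  suff : (\rank A < \rank (A + u)%MS)%N by lia.
  have : (A < A + u)%MS.
    by rewrite /ltmx addsmxSl addsmx_sub submx_refl /=.
  by rewrite ltmxErank => /andP[].
rewrite (mx11_scalar c) mul_scalar_mx addrC; apply: VD => //.
by apply: AV; apply: submxMl.
Qed.

Lemma subspace_sep (V : 'rV[K]_N -> Prop) r : is_subspace V -> ~ V r ->
  exists c : 'cV[K]_N, (forall v, V v -> v *m c = 0) /\ r *m c != 0.
Proof.
move=> /subspace_mx[A VA] nVr; have : ~~ (r <= A)%MS by apply/negP => /VA.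
rewrite submxE => /matrix0Pn[i [j rj]]; exists (col j (cokermx A)); split=> [v /VA|].
  by rewrite submxE => /eqP vA; rewrite colE mulmxA vA mul0mx.
apply/matrix0Pn; exists i, 0; by rewrite colE mulmxA -colE mxE.
Qed.

End Separation.

(** * The invariant bilinear form *)

Section Pairing.
Context (K : numFieldType) (n : nat) (T : {set 'I_(n.*2.+1)}).
Hypothesis sgT : forall b, b \in T -> sg b \notin T.
Local Notation I := 'I_(n.*2.+1).
Local Notation A := {mpoly K[n.*2.+1]}.
Local Notation X := (weylX T).
Local Notation P := (weylP T).
Local Notation M := (@so_op K n T).
Implicit Types (a b : I) (mu : 'X_{1..n.*2.+1}).

(* With these signs, [quadric] is adjoint to [laplacian], and [so_op a b] to [so_op b a] up
   to sign. *)
Definition bform_sgn a : K := if sg a \in T then -1 else 1.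
Definition bform_wt mu : K := \prod_a (bform_sgn a ^+ mu a * (mu a)`!%:R).
Definition bform (f g : A) : K := \sum_(mu <- msupp f) f@_mu * (bform_wt mu * g@_mu).
Definition adj_sgn a : K := if (a \in T) || (sg a \in T) then -1 else 1.

Lemma bform_supp (r : seq 'X_{1..n.*2.+1}) f g : uniq r -> {subset msupp f <= r} ->
  bform f g = \sum_(mu <- r) f@_mu * (bform_wt mu * g@_mu).
Proof.
move=> ur sr; rewrite [RHS](bigID (mem (msupp f))) /= [X in _ + X]big1 ?addr0.
  rewrite -big_filter; apply: perm_big; apply: uniq_perm; rewrite ?filter_uniq //.
  by move=> mu; rewrite mem_filter /=; case: (boolP (mu \in msupp f)) => // /sr ->.
by move=> mu /memN_msupp_eq0 ->; rewrite mul0r.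
Qed.

Lemma bform_linl g : scalar (bform^~ g).
Proof.
move=> c f h /=; pose r := undup (msupp (c *: f + h) ++ msupp f ++ msupp h).
have sub (u : A) : {subset msupp u <= msupp (c *: f + h) ++ msupp f ++ msupp h} ->
    bform u g = \sum_(mu <- r) u@_mu * (bform_wt mu * g@_mu).
  by move=> hu; apply: bform_supp; [apply: undup_uniq | move=> mu /hu; rewrite mem_undup].
rewrite !sub; try by move=> mu hmu; rewrite !mem_cat hmu ?orbT.
rewrite mulr_sumr -big_split; apply: eq_bigr => mu _ /=.
by rewrite mcoeffD mcoeffZ; ring.
Qed.

Lemma bform_linr f : scalar (bform f).
Proof.
move=> c g h; rewrite mulr_sumr -big_split; apply: eq_bigr => mu _ /=.
by rewrite mcoeffD mcoeffZ; ring.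
Qed.

Lemma bformX mu g : bform 'X_[mu] g = bform_wt mu * g@_mu.
Proof. by rewrite /bform msuppX big_seq1 mcoeffX eqxx mul1r. Qed.

Lemma bform0l g : bform 0 g = 0.
Proof. by rewrite /bform msupp0 big_nil. Qed.

Lemma bform0r f : bform f 0 = 0.
Proof. by rewrite /bform big1 // => mu _; rewrite mcoeff0 !mulr0. Qed.

Lemma bformDr f g h : bform f (g + h) = bform f g + bform f h.
Proof. by have := bform_linr f 1 g h; rewrite scale1r mul1r. Qed.

Lemma bformZr f c g : bform f (c *: g) = c * bform f g.
Proof. by have := bform_linr f c g 0; rewrite !addr0 bform0r addr0. Qed.

Lemma bform_sumr (J : Type) (r : seq J) (Q : pred J) f (F : J -> A) :
  bform f (\sum_(j <- r | Q j) F j) = \sum_(j <- r | Q j) bform f (F j).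
Proof. exact: (big_morph _ (bformDr f) (bform0r f)). Qed.

Lemma bformC f g : bform f g = bform g f.
Proof.
pose r := undup (msupp f ++ msupp g).
rewrite !(@bform_supp r) ?undup_uniq //;
  try by move=> mu hmu; rewrite mem_undup mem_cat hmu ?orbT.
by apply: eq_bigr => mu _; ring.
Qed.

Lemma bform_wtDU mu a :
  bform_wt (mu + U_(a)) = bform_wt mu * (bform_sgn a * (mu a).+1%:R).
Proof.
rewrite /bform_wt (bigD1 a) //= [in RHS](bigD1 a) //= mnmDE mnm1E eqxx addn1.
rewrite (eq_bigr (fun b => bform_sgn b ^+ mu b * (mu b)`!%:R)) => [|b ba]; last first.
  by rewrite mnmDE mnm1E eq_sym (negPf ba) addn0.
by rewrite exprS factS natrM; ring.
Qed.

Lemma bform_wt_neq0 mu : bform_wt mu != 0.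
Proof.
apply/prodf_neq0 => a _; rewrite mulf_neq0 ?pnatr_eq0 -?lt0n ?fact_gt0 //.
by rewrite expf_neq0 // /bform_sgn; case: ifP; rewrite ?oppr_eq0 oner_neq0.
Qed.

(** The factorials make x_a and d_a adjoint. On T the minus sign in P_a gives [adj_sgn a] = -1, and
    [bform_sgn] imposes the same sign on sg a, so that the signs cancel in [bform_quadric]. *)
Lemma bform_weylX a f g : bform (X a f) g = adj_sgn a * bform f (P a g).
Proof.
elim/mpolyind: f => [|c mu f _ _ IHf]; first by rewrite linear0 !bform0l mulr0.
rewrite linearP /= !bform_linl IHf mulrDr [X in _ = X + _]mulrCA; congr (c * _ + _).
rewrite bformX; rewrite /weylX /weylP /adj_sgn; case: ifP => aT /=.
  have sa : bform_sgn a = 1 by rewrite /bform_sgn (negPf (sgT aT)).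
  rewrite mderivX mcoeffN mcoeff_mulX mulN1r mulrN opprK.
  rewrite -[_ *: _]addr0 bform_linl bform0l addr0 bformX; case: posnP => [->|mu0].
    by rewrite mul0r mulr0.
  rewrite -[in bform_wt mu](mnm_subK mu0) bform_wtDU sa mul1r mnmBE mnm1E eqxx subn1.
  by rewrite prednK //; ring.
rewrite -mpolyXD bformX addmC bform_wtDU mcoeff_deriv -mulr_natl /bform_sgn.
by case: ifP => _; ring.
Qed.

Lemma adj_sgn2 a : adj_sgn a * adj_sgn a = 1.
Proof. by rewrite /adj_sgn; case: ifP => _; rewrite ?mulrNN mulr1. Qed.

Lemma adj_sgn_sg a : adj_sgn (sg a) = adj_sgn a.
Proof. by rewrite /adj_sgn sgK orbC. Qed.

Lemma bform_weylP a f g : bform (P a f) g = adj_sgn a * bform f (X a g).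
Proof. by rewrite bformC [bform f _]bformC bform_weylX mulrA adj_sgn2 mul1r. Qed.

Lemma bform_so_op a b f g : bform (M a b f) g = adj_sgn a * adj_sgn b * bform f (M b a g).
Proof.
rewrite /so_op addrC -scaleN1r bform_linl !bform_weylX !bform_weylP !adj_sgn_sg.
by rewrite bformDr -scaleN1r bformZr; ring.
Qed.

Lemma bform_quadric f g : bform (quadric T f) g = bform f (laplacian T g).
Proof.
rewrite bformC !bform_sumr; apply: eq_bigr => b _.
by rewrite bformC !bform_weylX adj_sgn_sg mulrA adj_sgn2 mul1r.
Qed.

End Pairing.

(** * Projections of submodules and separating polynomials *)

Section Projection.
Context (K : numFieldType) (n : nat) (T : {set 'I_(n.*2.+1)}).
Hypothesis sgT : forall b, b \in T -> sg b \notin T.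
Local Notation I := 'I_(n.*2.+1).
Local Notation A := {mpoly K[n.*2.+1]}.
Local Notation M := (@so_op K n T).
Implicit Types (a b : I) (mu : 'X_{1..n.*2.+1}) (f g : A).

Definition wT a : int := if (a \in T) || (sg a \in T) then 1 else 0.
Definition degT mu : int := wdeg wT mu.

(** On x^mu the Cartan operator [M i i] with i in T is multiplication by -(mu i + mu (sg i) + 1);
    subtracting #|T| removes the constants. *)
Definition degT_op f : A := - (\sum_(i in T) M i i f) - #|T|%:R *: f.

Lemma mcoeff_degT_op f mu : (degT_op f)@_mu = (degT mu)%:~R * f@_mu.
Proof.
rewrite /degT_op mcoeffB mcoeffN mcoeffZ raddf_sum /=.
rewrite (eq_bigr (fun i => - ((mu i)%:R + (mu (sg i))%:R + 1) * f@_mu)) => [|i iT]; last first.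
  rewrite /so_op mcoeffB !mcoeff_weylXP /weyl_ev iT (negPf (sgT iT)).
  by rewrite -addn1 natrD; ring.
rewrite -mulr_suml sumrN mulNr opprK -mulrBl; congr (_ * _).
rewrite big_split /= sumr_const addrK /degT /wdeg (big_morph intr (intrD K) (erefl _)).
rewrite [RHS](bigID (mem T)) /= big_split /=; congr (_ + _).
  by apply: eq_bigr => i iT; rewrite /wT iT mul1r.
rewrite (reindex_inj (can_inj (@sgK n))) /= big_mkcond [RHS]big_mkcond.
apply: eq_bigr => a _; rewrite /wT sgK.
have [aT|aT] := boolP (sg a \in T).
  by have := sgT aT; rewrite sgK => aT'; rewrite aT' orbT mul1r.
by rewrite orbF; case: (a \in T) => //=; rewrite mul0r.
Qed.

Definition degT_proj d f : A := \sum_(mu <- msupp f | degT mu == d) f@_mu *: 'X_[mu].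

Lemma mcoeff_degT_proj d f mu : (degT_proj d f)@_mu = if degT mu == d then f@_mu else 0.
Proof.
rewrite {2}[f]mpolyE !raddf_sum /=; case: ifP => hd.
  rewrite [RHS](bigID (fun nu => degT nu == d)) /= [X in _ + X]big1 ?addr0 // => nu hnu.
  rewrite mcoeffZ mcoeffX; case: (nu =P mu) => [E|_]; last by rewrite mulr0.
  by rewrite E hd in hnu.
rewrite big1 // => nu hnu; rewrite mcoeffZ mcoeffX.
case: (nu =P mu) => [E|_]; last by rewrite mulr0.
by rewrite E hd in hnu.
Qed.

Lemma subspaceD (W : A -> Prop) f g : is_subspace W -> W f -> W g -> W (f + g).
Proof. by move=> [_ WD] *; rewrite -[f]scale1r; apply: WD. Qed.

Lemma subspaceZ (W : A -> Prop) c f : is_subspace W -> W f -> W (c *: f).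
Proof. by move=> [W0 WD] *; rewrite -[_ *: _]addr0; apply: WD. Qed.

(* Lagrange interpolation in [degT_op]. *)
Lemma submodule_degT_proj (W : A -> Prop) d f :
  so_submodule T W -> W f -> W (degT_proj d f).
Proof.
move=> /so_submoduleP[subW WM] Wf.
have WN g : W g -> W (- g) by rewrite -scaleN1r; apply: subspaceZ.
have Wdeg g : W g -> W (degT_op g).
  move=> Wg; apply: (subspaceD subW); apply: WN; last exact: subspaceZ.
  apply: big_ind => [||i _]; [by case: subW | by move=> *; apply: subspaceD | exact: WM].
pose step (e : int) g := ((d - e)%:~R^-1 : K) *: (degT_op g - e%:~R *: g).
have Wstep L : W (foldr step f L).
  elim: L => //= e L WL; apply: (subspaceZ _ subW); apply: (subspaceD subW); first exact: Wdeg.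
  by apply: WN; apply: (subspaceZ _ subW).
have stepE L mu : (foldr step f L)@_mu =
    \prod_(e <- L) ((degT mu - e)%:~R / (d - e)%:~R) * f@_mu.
  elim: L => [|e L IHL] /=; first by rewrite big_nil mul1r.
  rewrite big_cons -mulrA -IHL mcoeffZ mcoeffB mcoeffZ mcoeff_degT_op -mulrBl -intrB.
  by rewrite mulrCA mulrA.
pose L := [seq degT mu | mu <- msupp f & degT mu != d].
suff -> : degT_proj d f = foldr step f L by [].
apply/mpolyP => mu; rewrite mcoeff_degT_proj stepE.
case: eqP => [->|/eqP hd].
  rewrite big_seq big1 ?mul1r // => e /mapP[nu]; rewrite mem_filter => /andP[hnu _] ->.
  by rewrite divff // intr_eq0 subr_eq0 eq_sym.
have [->|fmu] := eqVneq f@_mu 0; first by rewrite mulr0.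
rewrite (big_rem (degT mu)) /=; last by apply: map_f; rewrite mem_filter hd mcoeff_msupp.
by rewrite subrr !mul0r.
Qed.

Lemma degT_proj_sum (W : A -> Prop) f : is_subspace W ->
  (forall d, W (degT_proj d f)) -> W f.
Proof.
move=> subW Wf; pose L := undup [seq degT mu | mu <- msupp f].
suff -> : f = \sum_(d <- L) degT_proj d f.
  by apply: big_ind => // [|u v]; [case: subW | apply: subspaceD].
apply/mpolyP => mu; rewrite raddf_sum /=.
under eq_bigr do rewrite mcoeff_degT_proj.
have [E|fmu] := eqVneq f@_mu 0; first by rewrite E big1 // => d _; case: ifP.
rewrite (bigD1_seq (degT mu)) ?undup_uniq //=; last first.
  by rewrite mem_undup map_f // mcoeff_msupp.
by rewrite eqxx big1 ?addr0 // => d; rewrite eq_sym => /negPf->.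
Qed.

(** Hence only finitely many monomials have a prescribed grade and a prescribed [degT]. *)
Lemma mdeg_degT mu : (mdeg mu)%:Z <= wdeg (sgnT T) mu + 2 * degT mu.
Proof.
rewrite mdegE (big_morph Posz PoszD (erefl _)) /degT /wdeg mulr_sumr -big_split /=.
by apply: ler_sum => a _; rewrite /sgnT /wT; case: ifP; [|case: ifP] => *; rewrite /=; lia.
Qed.

(** A linear form on the finitely many monomials of grade k and [degT] d separates f from U;
    dividing its coefficients by [bform_wt] turns it into the pairing with h. Against an arbitrary u
    in U, h only sees the component of [degT] d, which again lies in U. *)
Lemma separating_poly k d (U : A -> Prop) f : so_submodule T U ->
  (forall u, U u -> graded T k u) -> graded T k f -> isobaric wT d f -> ~ U f ->
  exists h, [/\ graded T k h, forall u, U u -> bform T u h = 0 & bform T f h != 0].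
Proof.
(* N exceeds the bound k + 2d on the total degree given by [mdeg_degT]. *)
move=> subU Uk fk fd nUf; pose N := `|(k + 2 * d + 1)%R|%N.
pose B : finType := 'X_{1..n.*2.+1 < N}.
pose coord (g : A) : 'rV[K]_#|B| := \row_i g@_(enum_val i : B).
have coordD c g h : coord (c *: g + h) = c *: coord g + coord h.
  by apply/rowP => i; rewrite !mxE mcoeffD mcoeffZ.
have small mu : wdeg (sgnT T) mu = k -> degT mu = d -> (mdeg mu < N)%N.
  by move=> h1 h2; have := mdeg_degT mu; rewrite h1 h2 /N; lia.
pose V r := exists2 u, U u /\ isobaric wT d u & coord u = r.
have subV : is_subspace V.
  split=> [|c r1 r2 [u [Uu du] <-] [v [Uv dv] <-]].
    exists 0; last by apply/rowP => i; rewrite !mxE mcoeff0.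
    by split; [case: subU => -[] | apply: isobaric0].
  exists (c *: u + v); last exact: coordD.
  by split; [case: subU => -[_ h] _; apply: h | apply: isobaric_lin].
have nVf : ~ V (coord f).
  move=> [u [Uu du] E]; apply: nUf; suff -> : f = u by [].
  apply/mpolyP => mu; have [lt|ge] := ltnP (mdeg mu) N.
    have := congr1 (fun r : 'rV__ => r 0 (enum_rank (BMultinom lt : B))) E.
    by rewrite !mxE enum_rankK.
  have out g : graded T k g -> isobaric wT d g -> g@_mu = 0.
    move=> gk gd; apply/eqP/negPn/negP => g0; move: ge; rewrite leqNgt.
    by rewrite small ?gk //; apply: gd.
  by rewrite !out //; apply: Uk.
have [c [Vc fc]] := subspace_sep subV nVf.
pose inF mu := (wdeg (sgnT T) mu == k) && (degT mu == d).
pose h : A := \sum_(b : B | inF b) (c (enum_rank b) 0 / bform_wt K T b) *: 'X_[b].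
have hF g : isobaric wT d g -> graded T k g -> bform T g h = (coord g *m c) 0 0.
  move=> gd gk; rewrite bform_sumr mxE (reindex _ (onW_bij _ (@enum_rank_bij B))) /= big_mkcond.
  apply: eq_bigr => b _; rewrite mxE enum_rankK; case: ifP => [_|/negbT].
    rewrite bformZr bformC bformX; have := bform_wt_neq0 K T b.
    by move=> w0; rewrite mulrA mulfVK // mulrC.
  rewrite /inF; have [->|g0] := eqVneq g@_b 0; first by rewrite mul0r.
  by rewrite (gk _ g0) eqxx /degT (gd _ g0) eqxx.
have hk : graded T k h.
  by apply: isobaric_sum => b /andP[/eqP <- _]; apply/isobaricZ/isobaricX.
have hd : isobaric wT d h.
  by apply: isobaric_sum => b /andP[_ /eqP <-]; apply/isobaricZ/isobaricX.
exists h; split=> // [u Uu|]; last first.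
  rewrite hF //; apply: contraNneq fc => E; apply/eqP/matrixP => i j.
  by rewrite !ord1 E mxE.
have -> : bform T u h = bform T (degT_proj d u) h.
  rewrite bformC [RHS]bformC; apply: eq_big_seq => mu; rewrite mcoeff_msupp => /hd E.
  by rewrite mcoeff_degT_proj /degT E eqxx.
have Up := submodule_degT_proj d subU Uu.
have dp : isobaric wT d (degT_proj d u).
  by move=> mu; rewrite mcoeff_degT_proj; case: (degT mu =P d) => // _; rewrite eqxx.
rewrite hF //; last exact: Uk.
by rewrite Vc ?mxE //; exists (degT_proj d u).
Qed.

End Projection.

(** * Irreducibility of the harmonic module *)

Section Irreducible.
Context (K : numFieldType) (n s : nat).
Hypotheses (s1 : (1 <= s)%N) (sn : (s < n)%N).
Local Notation T := (Tset n s).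
Local Notation A := {mpoly K[n.*2.+1]}.
Local Notation sgT := (@sg_Tset n s sn).

Lemma hmon_graded k : graded T k ('X_[hmon n s k] : A).
Proof.
suff E : wdeg (sgnT T) (hmon n s k) = k.
  by move=> mu /isobaricX ->.
rewrite (@wdeg_hvar _ _ _ (hvar n s k)) => [|a ac]; last first.
  by rewrite /hmon mulmnE mnm1E eq_sym (negPf ac).
rewrite /hmon mulmnE mnm1E eqxx mul1n /sgnT /hvar.
by case: (lerP 0 k) => k0; rewrite ?(p_mid s1 sn) ?(l_T s1 sn); lia.
Qed.

Lemma harmonic_irreducible k : (exists2 f : A, harmonic s k f & f != 0) ->
  so_irreducible T (@harmonic K n s k).
Proof.
move=> ne; split=> // [|U subU UH]; first exact: harmonic_submodule.
have [U0|nU0] := boolp.EM (forall f, U f -> f = 0); [by left | right=> f0 Hf0].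
have [u Uu u0] : exists2 u, U u & u != 0.
  apply: boolp.contrapT => no; apply: nU0 => u Uu; apply/eqP/negPn/negP => u0.
  by apply: no; exists u.
apply: boolp.contrapT => nUf0.
have [d nUf] : exists d, ~ U (degT_proj T d f0).
  apply: boolp.contrapT => no; apply: nUf0; apply: (@degT_proj_sum _ _ T).
    by case: subU.
  by move=> d; apply: boolp.contrapT => nU; apply: no; exists d.
have Hf := submodule_degT_proj sgT d (@harmonic_submodule K n s k) Hf0.
set f := degT_proj _ _ _ in nUf Hf.
have fd : isobaric (wT T) d f.
  by move=> mu; rewrite mcoeff_degT_proj; case: (_ =P d) => // _; rewrite eqxx.
have Uk v : U v -> graded T k v by move=> /UH[].
have [h [hk Uh fh]] := separating_poly sgT subU Uk Hf.1 fd nUf.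
have [/(_ h)[/(_ hk)[h0 [v [Hh0 [g _ Ev] Eh]]] _] _] := @graded_direct_sum K n T sgT k.
(* Harmonic polynomials are orthogonal to the image of [quadric], so h may be replaced by its
   harmonic part h0. *)
have ph0 w : harmonic s k w -> bform T w h = bform T w h0.
  move=> [_ lw]; rewrite Eh bformDr Ev [bform T w (quadric _ _)]bformC.
  by rewrite (bform_quadric sgT) lw bform0r addr0.
pose W w := harmonic s k w /\ forall v, U v -> bform T v w = 0.
have subW : so_submodule T W.
  have [[H0 HD] HM] := (so_submoduleP T (@harmonic K n s k)).1 (@harmonic_submodule K n s k).
  apply/so_submoduleP; split; first split.
  - by split=> // x _; rewrite bform0r.
  - move=> c x y [Hx Ux] [Hy Uy]; split=> [|z Uz]; first exact: HD.
    by rewrite bform_linr Ux // Uy // mulr0 addr0.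
  - move=> a b x [Hx Ux]; split=> [|z Uz]; first exact: HM.
    rewrite bformC (bform_so_op sgT) bformC Ux ?mulr0 //.
    by have [_ UM] := (so_submoduleP T U).1 subU; apply: UM.
have Wh0 : W h0 by split=> // x Ux; rewrite -ph0 ?Uh //; apply: UH.
have h00 : h0 != 0.
  by apply: contraNneq fh => E; rewrite ph0 // E bform0r.
have := submodule_hmon s1 sn subU UH Uu u0.
have [_ +] := submodule_hmon s1 sn subW (fun g (Wg : W g) => Wg.1) Wh0 h00.
move=> /[apply]; rewrite bformX mcoeffX eqxx mulr1 => /eqP.
by rewrite (negPf (bform_wt_neq0 _ _ _)).
Qed.

End Irreducible.

(** * The singular monomial and its weight *)

Section Weights.
Context (K : numFieldType) (n s : nat).
Hypotheses (s1 : (1 <= s)%N) (sn : (s < n)%N).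
Local Notation T := (Tset n s).
Local Notation I := 'I_(n.*2.+1).
Local Notation A := {mpoly K[n.*2.+1]}.
Local Notation X := (weylX T).
Local Notation P := (weylP T).
Local Notation M := (@so_op K n T).
Local Notation lo i := (idx n i.+1).
Local Notation hi i := (idx n (n + i.+1)).
Variable k : int.
Local Notation v := ('X_[hmon n s k] : A).

Definition hpos : nat := if 0 <= k then s.+1 else s.

Lemma hvarE : hvar n s k = lo hpos.
Proof. by rewrite /hvar /hpos; case: ifP. Qed.

Lemma hpos_le : (1 <= hpos <= n)%N.
Proof. by rewrite /hpos; case: ifP; lia. Qed.

Lemma weylP_hmon b : b \notin T -> b != hvar n s k -> P b v = 0.
Proof.
move=> bT bc; rewrite weylP_deriv // mderivX /hmon mulmnE mnm1E eq_sym (negPf bc).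
by rewrite mul0n scale0r.
Qed.

Lemma weylXP_hmon a b : a \in T -> a != hvar n s k -> b != a -> X a (P b v) = 0.
Proof.
move=> aT ac ba; have := weylPX T b a v; rewrite (negPf ba) scale0r addr0 => <-.
rewrite weylX_deriv // mderivX /hmon mulmnE mnm1E eq_sym (negPf ac) mul0n scale0r.
by rewrite linear0.
Qed.

Lemma weylP_hi_hmon i : (1 <= i <= n)%N -> P (hi i) v = 0.
Proof.
move=> hin; have hp := hpos_le; apply: weylP_hmon; first by rewrite (idx_hi_Tset sn).
by rewrite hvarE eq_idx; lia.
Qed.

Lemma weylP_one_hmon : P (idx n 1) v = 0.
Proof.
have hp := hpos_le; apply: weylP_hmon; first by rewrite (idx1_Tset sn).
by rewrite hvarE eq_idx; lia.
Qed.

Lemma weylP_lo_hmon i : (s < i <= n)%N -> i != hpos -> P (lo i) v = 0.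
Proof.
move=> hin ip; have hp := hpos_le; apply: weylP_hmon; first by rewrite (idx_lo_Tset sn); lia.
by rewrite hvarE eq_idx; lia.
Qed.

Lemma weylXP_lo_hmon i j : (1 <= i <= s)%N -> (1 <= j <= n)%N -> i != hpos -> i != j ->
  X (lo i) (P (lo j) v) = 0.
Proof.
move=> hin hjn ip ij; have hp := hpos_le.
apply: weylXP_hmon; first by rewrite (idx_lo_Tset sn); lia.
  by rewrite hvarE eq_idx; lia.
by rewrite eq_idx; lia.
Qed.

Lemma hmon_harmonic : harmonic s k v.
Proof.
split; first exact: hmon_graded.
rewrite /laplacian big_idx /= sg_idx1 weylP_one_hmon linear0 add0r.
rewrite big_nat big1 // => i hin; have {}hin : (1 <= i <= n)%N by lia.
rewrite (@sg_idx_lo n i) // (@sg_idx_hi n i) // weylP_hi_hmon // linear0 addr0.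
by rewrite weylPC weylP_hi_hmon ?linear0.
Qed.

Lemma hmon_so_pos g : so_pos g -> gl_act T g v = 0.
Proof.
move=> [m [b [c [hb ->]]]]; rewrite gl_act_sum big1 // => j _.
have hp := hpos_le.
suff -> : gl_act T (b j) v = 0 by rewrite scaler0.
case: (hb j) => [i i' i1 ii' i'n|i i' i1 ii' i'n|i i1 i_n].
- have -> : Emx K n i.+1 i'.+1 - Emx K n (n + i'.+1) (n + i.+1) = so_mx K (lo i) (lo i').
    by rewrite /so_mx !sg_idx_lo //; lia.
  rewrite gl_act_so_mx /so_op (@sg_idx_lo n i); last by lia.
  rewrite weylP_hi_hmon; last by lia.
  rewrite linear0 subr0.
  (* In the first case P_{lo i'} already kills the monomial. Otherwise i < i' forces i <= s and i !=
     hpos, because hpos is s or s+1, and X_{lo i} is a derivative in an absent variable. *)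
  have [/andP[? ?]|i's] := boolP ((s < i')%N && (i' != hpos)).
    by rewrite weylP_lo_hmon ?linear0 //; lia.
  have hposE : hpos = s \/ hpos = s.+1 by rewrite /hpos; case: ifP; [right | left].
  by apply: weylXP_lo_hmon; lia.
- have -> : Emx K n i.+1 (n + i'.+1) - Emx K n i'.+1 (n + i.+1) = so_mx K (lo i) (hi i').
    by rewrite /so_mx (@sg_idx_lo n i) ?(@sg_idx_hi n i') //; lia.
  rewrite gl_act_so_mx /so_op (@sg_idx_lo n i); last by lia.
  rewrite (@weylP_hi_hmon i) ?(@weylP_hi_hmon i'); try lia.
  by rewrite !linear0 addr0.
- have -> : Emx K n i.+1 1 - Emx K n 1 (n + i.+1) = so_mx K (lo i) (idx n 1).
    by rewrite /so_mx sg_idx1 sg_idx_lo //; lia.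
  rewrite gl_act_so_mx /so_op sg_idx1 (@sg_idx_lo n i); last by lia.
  rewrite weylP_one_hmon (@weylP_hi_hmon i); last by lia.
  by rewrite !linear0 addr0.
Qed.

(** Coordinates of the weight on the Cartan generators. The -1 for i <= s is the term -delta_{i,j}
    of the action on T; for k < 0 the exponent -k sits on a variable of T and again contributes
    +k. *)
Definition hwt (i : nat) : int := - (i <= s)%N%:Z + (if i == hpos then k else 0).

Definition cartan_mx i : 'M[K]_(n.*2.+1) := Emx K n i.+1 i.+1 - Emx K n (n + i.+1) (n + i.+1).

Lemma cartan_mx_hmon i : (1 <= i <= n)%N ->
  gl_act T (cartan_mx i) v = (hwt i)%:~R *: v.
Proof.
move=> hin; have -> : cartan_mx i = so_mx K (lo i) (lo i) by rewrite /so_mx sg_idx_lo.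
rewrite gl_act_so_mx /so_op sg_idx_lo // weylP_hi_hmon // linear0 subr0.
apply/mpolyP => mu; rewrite mcoeff_weylXP mcoeffZ mcoeffX.
case: eqP => [<-|_]; rewrite ?mulr0 // !mulr1 /weyl_ev /hmon mulmnE mnm1E hvarE.
have := hpos_le => hp.
rewrite idx_lo_Tset // eq_idx /hwt; try lia.
rewrite eqSS [hpos == i]eq_sym /hpos; case: (lerP 0 k) => k0.
  case: leqP => is_; first by rewrite (_ : (i == s.+1) = false) ?mul0n; [|lia].
  by case: eqP => _; rewrite ?mul0n // mul1n add0r; case: k k0.
case: leqP => is_; last by rewrite (_ : (i == s) = false) ?mul0n; [|lia].
case: eqP => _; rewrite ?mul0n // mul1n.
by rewrite -[_.+1%:R]/((`|k|.+1)%:Z%:~R) -mulrNz; congr (_%:~R); lia.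
Qed.

Lemma cartan_genP g : cartan_gen g -> exists2 i, (1 <= i <= n)%N & g = cartan_mx i.
Proof. by case=> i i1 i_n; exists i; rewrite ?i1. Qed.

Lemma hmon_singular : singular_vector T v.
Proof.
split; [exact: mpolyX_neq0 | | exact: hmon_so_pos].
move=> h [m [b [c [hb ->]]]].
have /fin_all_exists[e he] i : exists e : K, gl_act T (b i) v = e *: v.
  have [j hj ->] := cartan_genP (hb i).
  by exists (hwt j)%:~R; apply: cartan_mx_hmon.
exists (\sum_i c i * e i); rewrite gl_act_sum scaler_suml.
by apply: eq_bigr => i _; rewrite he scalerA.
Qed.

Lemma scalar_span (mu : 'M[K]_(n.*2.+1) -> K) m (c : 'I_m -> K) b : scalar mu ->
  mu (\sum_i c i *: b i) = \sum_i c i * mu (b i).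
Proof.
move=> mul; have mu0 : mu 0 = 0 by have := mul (-1) 0 0; rewrite scaler0 addr0 mulN1r addNr.
rewrite (big_morph mu (id1 := 0) (op1 := +%R)) // => [|x y].
  by apply: eq_bigr => i _; have := mul (c i) (b i) 0; rewrite mu0 !addr0.
by have := mul 1 x y; rewrite scale1r mul1r.
Qed.

(** The coroots determine mu on the Cartan generators by descending induction: the last coroot is
    twice the last generator, the others are differences of consecutive generators. *)
Lemma hmon_weight (mu : 'M[K]_(n.*2.+1) -> K) : scalar mu ->
  (forall i, (1 <= i < n)%N -> mu (coroot K n i) = (hwt i - hwt i.+1)%:~R) ->
  mu (coroot K n n) = (2 * hwt n)%:~R -> has_weight T mu v.
Proof.
move=> mul mui mun h [m [b [c [hb ->]]]].
rewrite gl_act_sum scalar_span // scaler_suml; apply: eq_bigr => i _.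
rewrite -scalerA; congr (_ *: _); have [j hj ->] := cartan_genP (hb i).
rewrite cartan_mx_hmon //; congr (_ *: _).
have muD x y : mu (x + y) = mu x + mu y by have := mul 1 x y; rewrite scale1r mul1r.
have muZ a x : mu (a *: x) = a * mu x.
  have := mul a x 0; have /(_ 0 0) := muD; rewrite !addr0 => E.
  by have /eqP := E; rewrite -subr_eq0 opprD addNKr oppr_eq0 => /eqP ->; rewrite addr0.
have [d -> {j hj}] : exists2 d, j = (n - d)%N & (d < n)%N by exists (n - j)%N; lia.
elim: d => [_|d IHd dn].
  rewrite subn0; apply: (mulfI (x := 2)); first by rewrite pnatr_eq0.
  rewrite -muZ -[2 in LHS]/(2%:~R) -intrM -mun; congr mu.
  by rewrite /coroot ltnn /cartan_mx addnS addnn.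
have E : (n - d = (n - d.+1).+1)%N by lia.
have := IHd (ltnW dn); rewrite E => {}IHd.
have := mui (n - d.+1)%N; rewrite intrB IHd.
have -> : coroot K n (n - d.+1) = cartan_mx (n - d.+1) + -1 *: cartan_mx (n - d.+1).+1.
  rewrite /coroot ifT; last by lia.
  by rewrite /cartan_mx scaleN1r opprB addrA addrAC.
by rewrite muD muZ mulN1r => /(_ ltac:(lia))/addIr ->.
Qed.

End Weights.

(** * Degrees and derivatives of products *)

Section Products.
Context (K : numFieldType) (m : nat).
Local Notation A := {mpoly K[m]}.
Implicit Types (f g : A) (w : 'I_m -> int).

Lemma wdegD w (mu nu : 'X_{1..m}) : wdeg w (mu + nu) = wdeg w mu + wdeg w nu.
Proof. by rewrite /wdeg -big_split; apply: eq_bigr => a _; rewrite mnmDE PoszD mulrDr. Qed.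

Lemma isobaricM w k l f g : isobaric w k f -> isobaric w l g -> isobaric w (k + l) (f * g).
Proof.
move=> hf hg mu; rewrite -mcoeff_msupp => /msuppM_le/allpairsP[[x y] /=].
by rewrite !mcoeff_msupp => -[/hf <- /hg <- ->]; rewrite wdegD.
Qed.

Lemma isobaric_prod w (J : Type) (r : seq J) (Q : pred J) (e : J -> int) (F : J -> A) :
  (forall j, Q j -> isobaric w (e j) (F j)) ->
  isobaric w (\sum_(j <- r | Q j) e j) (\prod_(j <- r | Q j) F j).
Proof.
move=> hF; elim/big_rec2: _ => [|j k f Qj hf]; last by apply: isobaricM => //; apply: hF.
move=> mu; rewrite mcoeff1; case: (mu =P 0%MM) => [-> _|_]; last by rewrite eqxx.
by rewrite /wdeg big1 // => a _; rewrite mnm0E mulr0.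
Qed.

Lemma isobaricXn w (a : 'I_m) e : isobaric w (w a * e%:Z) ('X_a ^+ e : A).
Proof.
suff E : wdeg w (U_(a) *+ e)%MM = w a * e%:Z by rewrite mpolyXn => mu /isobaricX ->.
rewrite /wdeg (bigD1 a) //= mulmnE mnm1E eqxx mul1n big1 ?addr0 // => b ba.
by rewrite mulmnE mnm1E eq_sym (negPf ba) mulr0.
Qed.

Lemma mderiv_expX (a b : 'I_m) e :
  ('X_a ^+ e : A)^`M(b) = if a == b then e%:R *: 'X_a ^+ e.-1 else 0.
Proof.
elim: e => [|e IHe]; first by rewrite expr0 -mpolyC1 mderivC scale0r; case: ifP.
rewrite exprS mderiv_mulX IHe eq_sym; case: eqP => _; last by rewrite mulr0 scale0r addr0.
case: e {IHe} => [|e] /=; first by rewrite expr0 scale0r mulr0 add0r.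
by rewrite -scalerAr -exprS -scalerDl -natrD addn1.
Qed.

Lemma mderiv_prod0 (J : Type) (r : seq J) (Q : pred J) (F : J -> A) b :
  (forall j, Q j -> (F j)^`M(b) = 0) -> (\prod_(j <- r | Q j) F j)^`M(b) = 0.
Proof.
move=> hF; elim/big_rec: _ => [|j f Qj hf]; first by rewrite -mpolyC1 mderivC.
by rewrite mderivM hf hF // mul0r mulr0 addr0.
Qed.

Lemma mderivM_l (f g : A) b : f^`M(b) = 0 -> (f * g)^`M(b) = f * g^`M(b).
Proof. by move=> h; rewrite mderivM h mul0r add0r. Qed.

Lemma mderivM_r (f g : A) b : g^`M(b) = 0 -> (f * g)^`M(b) = f^`M(b) * g.
Proof. by move=> h; rewrite mderivM h mulr0 addr0. Qed.

Lemma scaler_big (J : Type) (r : seq J) (Q : pred J) (c : J -> K) (F : J -> A) :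
  \prod_(j <- r | Q j) (c j *: F j) =
  (\prod_(j <- r | Q j) c j) *: \prod_(j <- r | Q j) F j.
Proof.
elim/big_rec3: _ => [|j x y z _ ->]; first by rewrite scale1r.
by rewrite -scalerAl -scalerAr scalerA.
Qed.

End Products.

(** * Factorization of the basis terms *)

Section Basis.
Context (K : numFieldType) (n s : nat).
Local Notation T := (Tset n s).
Local Notation A := {mpoly K[n.*2.+1]}.
Local Notation lo j := (idx n j.+2).
Local Notation hi j := (idx n (n + j.+2)).
Local Notation o := (idx n 1).
Implicit Types (eps : nat) (a : nat -> nat) (j : 'I_n).

Lemma lo_eq j j' : (lo j == lo j') = (j == j').
Proof. by have hj := ltn_ord j; have hj' := ltn_ord j'; rewrite eq_idx; [rewrite -val_eqE | lia..]. Qed.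
Lemma hi_eq j j' : (hi j == hi j') = (j == j').
Proof. by have hj := ltn_ord j; have hj' := ltn_ord j'; rewrite eq_idx; [rewrite -val_eqE /=; lia | lia..]. Qed.
Lemma lo_hi j j' : (lo j == hi j') = false.
Proof. by have hj := ltn_ord j; have hj' := ltn_ord j'; rewrite eq_idx; lia. Qed.
Lemma hi_lo j j' : (hi j == lo j') = false.
Proof. by rewrite eq_sym lo_hi. Qed.
Lemma lo_o j : (lo j == o) = false.
Proof. by have hj := ltn_ord j; rewrite eq_idx; lia. Qed.
Lemma hi_o j : (hi j == o) = false.
Proof. by have hj := ltn_ord j; rewrite eq_idx; lia. Qed.

Lemma big_idx_ord (R : Type) (z : R) (op : Monoid.com_law z) (F : 'I_(n.*2.+1) -> R) :
  \big[op/z]_b F b = op (F o) (\big[op/z]_(j < n) op (F (lo j)) (F (hi j))).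
Proof. by rewrite big_idx big_add1 /= big_mkord. Qed.

Definition lap_pair j (f : A) : A :=
  if (j < s)%N then - ('X_(lo j) * f^`M(hi j)) else f^`M(hi j)^`M(lo j).

Hypothesis sn : (s < n)%N.

Lemma Delta_op_pair (f : A) :
  @Delta_op K n s f = f^`M(o)^`M(o) + 2 *: \sum_j lap_pair j f.
Proof.
rewrite /Delta_op -addrA -scalerN -scalerDr; congr (_ + 2 *: _).
rewrite -(big_mkord xpredT (fun j : nat => if (j < s)%N then - ('X_(lo j) * f^`M(hi j))
   else f^`M(hi j)^`M(lo j))).
rewrite (big_cat_nat (leq0n s) (ltnW sn)) /=.
rewrite -sumrN !big_add1 /=; congr (_ + _); apply: eq_big_nat => j hj.
  by rewrite ifT //; lia.
by rewrite ifF //; lia.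
Qed.

(* The factor of the basis polynomials in the variables [lo j] and [hi j]; the operator
   [lap_pair j] shifts its parameter [r]. *)
Definition basis_factor a (j r : nat) : A :=
  if (j < s)%N then
    'C(a (n + j.+2)%N, r)%:R *: ('X_(lo j) ^+ (a j.+2 + r) * 'X_(hi j) ^+ (a (n + j.+2)%N - r))
  else ((-1) ^+ r * ('C(a j.+2, r) * r`!)%N%:R * 'C(a (n + j.+2)%N, r)%:R) *:
    ('X_(lo j) ^+ (a j.+2 - r) * 'X_(hi j) ^+ (a (n + j.+2)%N - r)).

Definition basis_head eps (m : nat) : A :=
  (2 ^+ m * (eps`! * m`!)%N%:R / (eps + 2 * m)`!%:R) *: 'X_o ^+ (eps + 2 * m).

(** Separation of variables: apart from the product over the pairs, a term depends on r only through
    the sum of its entries, carried by the power of x_1. *)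
Lemma basis_termE eps a (r : nat -> nat) :
  @basis_term K n s eps a r =
  basis_head eps (\sum_(j < n) r j.+2) * \prod_(j < n) basis_factor a j (r j.+2).
Proof.
rewrite /basis_term.
have sumE : (\sum_(2 <= p < n.+2) r p = \sum_(j < n) r j.+2)%N.
  by rewrite 2!big_add1 /= big_mkord.
have sumE' : (\sum_(1 <= i < n.+1) r i.+1 = \sum_(j < n) r j.+2)%N.
  by rewrite big_add1 /= big_mkord.
rewrite sumE sumE' /basis_head; set m := (\sum_(j < n) _)%N.
rewrite -(big_mkord xpredT (fun j : nat => basis_factor a j (r j.+2))).
rewrite (big_cat_nat (leq0n s) (ltnW sn)) /=.
rewrite !big_add1 /= [X in _ * (X * _)](@eq_big_nat _ _ _ _ _ _ (fun j : nat => 'C(a (n + j.+2)%N, r j.+2)%:R *: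
  ('X_(lo j) ^+ (a j.+2 + r j.+2) * 'X_(hi j) ^+ (a (n + j.+2)%N - r j.+2)))); last first.
  by move=> j /andP[_ js]; rewrite /basis_factor js.
rewrite [X in _ * (_ * X)](@eq_big_nat _ _ _ _ _ _ (fun j : nat =>
    ((-1) ^+ r j.+2 * ('C(a j.+2, r j.+2) * (r j.+2)`!)%N%:R * 'C(a (n + j.+2)%N, r j.+2)%:R) *:
    ('X_(lo j) ^+ (a j.+2 - r j.+2) * 'X_(hi j) ^+ (a (n + j.+2)%N - r j.+2)))); last first.
  by move=> j /andP[sj _]; rewrite /basis_factor ltnNge sj.
rewrite !scaler_big -!scalerAl -!scalerAr !scalerA mulrA; congr (_ *: _).
rewrite (big_cat_nat (leq0n s) (ltnW sn)) /=.
rewrite [(\prod_(_ <- _) _ * _)%N%:R]natrM !natr_prod expr_sum !big_split /=.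
by set D := (_^-1); ring.
Qed.

End Basis.

(** * Differential recurrences for the factors *)

Section BasisHarmonic.
Context (K : numFieldType) (n s : nat).
Local Notation T := (Tset n s).
Local Notation A := {mpoly K[n.*2.+1]}.
Local Notation lo j := (idx n j.+2).
Local Notation hi j := (idx n (n + j.+2)).
Local Notation o := (idx n 1).
Local Notation pair_op := (@lap_pair K n s).
Local Notation pair_poly := (@basis_factor K n s).
Local Notation one_poly := (@basis_head K n).
Implicit Types (eps : nat) (a : nat -> nat) (j : 'I_n).

(** Each derivative produces a factor (m - r) C(m, r) = (r+1) C(m, r+1). Off T there are two of
    them; one factor r+1 is absorbed by r! and the sign by (-1)^r. *)
Lemma pair_poly_step a j r :
  pair_op j (pair_poly a j r) = - (r.+1%:R *: pair_poly a j r.+1).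
Proof.
have binS m : r.+1%:R * 'C(m, r.+1)%:R = (m - r)%:R * 'C(m, r)%:R :> K.
  by rewrite -!natrM mul_bin_left.
rewrite /lap_pair /basis_factor; case: (j < s)%N.
  rewrite mderivZ mderivM_l; last by rewrite mderiv_expX lo_hi.
  rewrite mderiv_expX eqxx -!scalerAr scalerA mulrA -exprS -subnS (addnS (a j.+2)).
  by rewrite scalerA binS mulrC.
rewrite mderivZ mderivM_l; last by rewrite mderiv_expX lo_hi.
rewrite mderiv_expX eqxx -!scalerAr !mderivZ mderivM_r; last by rewrite mderiv_expX hi_lo.
rewrite mderiv_expX eqxx -!scalerAl !scalerA -!subnS -scaleNr; congr (_ *: _).
have := binS (a j.+2); have := binS (a (n + j.+2)%N).
rewrite exprS factS !natrM => E1 E2; rewrite mulrC !mulrA.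
transitivity ((-1) ^+ r * r`!%:R * ((a j.+2 - r)%:R * 'C(a j.+2, r)%:R) *
  ((a (n + j.+2)%N - r)%:R * 'C(a (n + j.+2)%N, r)%:R) : K); first by ring.
by rewrite -E1 -E2; ring.
Qed.

Lemma mderiv_pair_poly a i r b : lo i != b -> hi i != b -> (pair_poly a i r)^`M(b) = 0.
Proof.
move=> /negPf lb /negPf hb; rewrite /basis_factor.
by case: (i < s)%N; rewrite mderivZ mderivM !mderiv_expX lb hb mul0r mulr0 addr0 scaler0.
Qed.

Lemma mderiv_one_poly eps m b : o != b -> (one_poly eps m)^`M(b) = 0.
Proof. by move=> /negPf ob; rewrite mderivZ mderiv_expX ob scaler0. Qed.

Lemma pair_opM j (f g : A) : f^`M(lo j) = 0 -> f^`M(hi j) = 0 ->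
  pair_op j (f * g) = f * pair_op j g.
Proof.
move=> fl fh; rewrite /lap_pair; case: (j < s)%N; rewrite !mderivM_l //.
by rewrite mulrCA mulrN.
Qed.

Lemma pair_op_term eps a m j (t : 'I_n -> nat) :
  pair_op j (one_poly eps m * \prod_(i < n) pair_poly a i (t i)) =
  - ((t j).+1%:R *: (one_poly eps m *
      \prod_(i < n) pair_poly a i (if i == j then (t i).+1 else t i))).
Proof.
rewrite (bigD1 j) //= [in RHS](bigD1 j) //= eqxx.
rewrite [in RHS](eq_bigr (fun i : 'I_n => pair_poly a i (t i))) => [|i /negPf->//].
set R := \prod_(i | i != j) _.
have R0 b : b = lo j \/ b = hi j -> R^`M(b) = 0.
  move=> hb; apply: mderiv_prod0 => i ij; apply: mderiv_pair_poly.
    by case: hb => ->; rewrite ?lo_eq ?lo_hi.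
  by case: hb => ->; rewrite ?hi_eq ?hi_lo.
have E g : one_poly eps m * (g * R) = one_poly eps m * R * g by rewrite mulrCA mulrC.
have op0 b : b = lo j \/ b = hi j -> (one_poly eps m * R)^`M(b) = 0.
  move=> hb; rewrite mderivM R0 // mderiv_one_poly ?mul0r ?mulr0 ?addr0 //.
  by case: hb => ->; rewrite eq_sym ?lo_o ?hi_o.
rewrite !E pair_opM; [|by apply: op0; left|by apply: op0; right].
by rewrite pair_poly_step mulrN -scalerAr.
Qed.

(** The coefficient 2^m m! / (eps + 2m)! is the normalization that produces exactly the factor 2m.
    For m = 0 both sides vanish because eps <= 1. *)
Lemma one_poly_step eps m : (eps <= 1)%N ->
  (one_poly eps m)^`M(o)^`M(o) = (2 * m)%:R *: one_poly eps m.-1.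
Proof.
move=> eps1; rewrite /basis_head mderivZ mderiv_expX eqxx !mderivZ mderiv_expX eqxx.
case: m => [|m].
  rewrite muln0 addn0 scale0r; case: eps eps1 => [|[|]] //= _.
    by rewrite scale0r scaler0.
  by rewrite scale0r !scaler0.
rewrite !scalerA (_ : (eps + 2 * m.+1)%N = (eps + 2 * m).+2); last by lia.
rewrite -!pred_Sn; congr (_ *: _); rewrite !factS !natrM exprS.
have f0 : (eps + 2 * m)`!%:R != 0 :> K by rewrite pnatr_eq0 -lt0n fact_gt0.
have nz q : q.+1%:R + (eps%:R + 2 * m%:R) != 0 :> K.
  by rewrite -natrM -!natrD pnatr_eq0.
by field; rewrite f0 (nz 0%N) (nz 1%N).
Qed.

End BasisHarmonic.

(** * Harmonicity and low coefficients of the basis polynomials *)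

Section BasisPoly.
Context (K : numFieldType) (n s : nat).
Hypothesis sn : (s < n)%N.
Local Notation T := (Tset n s).
Local Notation A := {mpoly K[n.*2.+1]}.
Local Notation lo j := (idx n j.+2).
Local Notation hi j := (idx n (n + j.+2)).
Local Notation o := (idx n 1).
Local Notation pair_op := (@lap_pair K n s).
Local Notation pair_poly := (@basis_factor K n s).
Local Notation one_poly := (@basis_head K n).
Local Notation basis_poly := (@basis_poly K n s).
Implicit Types (eps : nat) (a : nat -> nat) (j : 'I_n) (t : 'I_n -> nat) (mu : 'X_{1..n.*2.+1}).

Definition box a : nat := \sum_(2 <= p < n.*2.+2) a p.

Lemma box_hi a j : (a (n + j.+2) <= box a)%N.
Proof.
have hj := ltn_ord j; rewrite /box (bigD1_seq (n + j.+2)%N) ?iota_uniq ?leq_addr //=.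
by rewrite mem_index_iota; lia.
Qed.

Definition term eps a t : A :=
  one_poly eps (\sum_i t i)%N * \prod_(i < n) pair_poly a i (t i).

Lemma basis_polyE eps a :
  basis_poly eps a = \sum_(r : n.-tuple 'I_(box a).+1) term eps a (fun i => tnth r i).
Proof.
apply: eq_bigr => r _; rewrite basis_termE // /term.
have E (i : 'I_n) : nth 0%N (map val r) (i.+2 - 2)%N = tnth r i.
  by rewrite subn2 (nth_map ord0) ?size_tuple //= -tnth_nth.
by congr (one_poly _ _ * _); apply: eq_bigr => i _; rewrite E.
Qed.

Definition incr j t : 'I_n -> nat := fun i => if i == j then (t i).+1 else t i.

(** Chosen so that Delta telescopes: as 2m is the sum of the 2 t_j, the second derivative in x_1
    gives the sum of the [dterm eps a j t], while the j-th pair gives minus the same expression at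
    [incr j t]. *)
Definition dterm eps a j t : A :=
  (2 * t j)%N%:R *: (one_poly eps (\sum_i t i)%N.-1 * \prod_(i < n) pair_poly a i (t i)).

Lemma sum_incr j t : (\sum_i incr j t i = (\sum_i t i).+1)%N.
Proof.
rewrite (bigD1 j) //= [in RHS](bigD1 j) //= /incr eqxx addSn.
by congr (_ + _).+1; apply: eq_bigr => i /negPf->.
Qed.

Lemma eq_dterm eps a j t t' : t =1 t' -> dterm eps a j t = dterm eps a j t'.
Proof.
move=> E; rewrite /dterm E; congr (_ *: (one_poly _ _.-1 * _)); apply: eq_bigr => i _ //.
by rewrite E.
Qed.

Lemma Delta_term eps a t : (eps <= 1)%N ->
  @Delta_op K n s (term eps a t) = \sum_j (dterm eps a j t - dterm eps a j (incr j t)).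
Proof.
move=> eps1; rewrite Delta_op_pair // sumrB scaler_sumr -sumrN; congr (_ + _).
  have P0 : (\prod_(i < n) pair_poly a i (t i))^`M(o) = 0.
    by apply: mderiv_prod0 => i _; apply: mderiv_pair_poly; rewrite ?lo_o ?hi_o.
  rewrite /term !(mderivM_r _ P0) one_poly_step // -scalerAl /dterm -scaler_suml.
  by rewrite -natr_sum -big_distrr.
apply: eq_bigr => j _; rewrite pair_op_term // scalerN scalerA /dterm sum_incr.
by rewrite {1}/incr eqxx -natrM.
Qed.

Definition shift_tuple B j (r : n.-tuple 'I_B.+1) : n.-tuple 'I_B.+1 :=
  [tuple if i == j then ordS (tnth r i) else tnth r i | i < n].

Lemma shift_tuple_inj B j : injective (@shift_tuple B j).
Proof.
move=> r r' E; apply: eq_from_tnth => i; have := congr1 (fun x => tnth x i) E.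
by rewrite !tnth_mktuple; case: eqP => // _ /(can_inj (@ordSK B.+1)).
Qed.

Lemma pair_poly_box a j : pair_poly a j (box a).+1 = 0.
Proof.
have hb := box_hi a j; rewrite /basis_factor.
by rewrite (@bin_small (a (n + j.+2)%N)) ?ltnS //; case: ifP; rewrite ?mulr0 scale0r.
Qed.

(** The cyclic shift is a bijection of the index box, and its wrap-around is harmless: at r_j = box
    a the left side has the factor 2 * 0, and the right side a binomial with lower index box a + 1,
    which vanishes. *)
Lemma dterm_shift eps a j (r : n.-tuple 'I_(box a).+1) :
  dterm eps a j (fun i => tnth (shift_tuple j r) i) =
  dterm eps a j (incr j (fun i => tnth r i)).
Proof.
have [lt|ge] := ltnP (tnth r j) (box a).
  apply: eq_dterm => i; rewrite tnth_mktuple /incr; case: eqP => // -> /=.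
  by rewrite modn_small.
have E : tnth r j = box a :> nat by apply/eqP; rewrite eqn_leq ge -ltnS ltn_ord.
rewrite /dterm tnth_mktuple eqxx /= E modnn muln0 scale0r.
by rewrite [\prod_(i < n) _](bigD1 j) //= {3}/incr eqxx E pair_poly_box mul0r mulr0 scaler0.
Qed.

Lemma Delta_basis_poly eps a : (eps <= 1)%N -> @Delta_op K n s (basis_poly eps a) = 0.
Proof.
move=> eps1; rewrite basis_polyE Delta_opE // linear_sum /=.
under eq_bigr do rewrite -Delta_opE // Delta_term //.
rewrite exchange_big big1 //= => j _; rewrite sumrB.
rewrite [X in X - _](reindex_inj (@shift_tuple_inj (box a) j)) /=.
by under eq_bigr do rewrite dterm_shift; rewrite subrr.
Qed.

Definition bmon eps a : 'X_{1..n.*2.+1} :=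
  [multinom if (i == 0 :> nat)%N then eps else a i.+1 | i < n.*2.+1].

Lemma bmon_o eps a : bmon eps a o = eps.
Proof. by rewrite mnmE val_idx. Qed.
Lemma bmon_lo eps a j : bmon eps a (lo j) = a j.+2.
Proof. by have hj := ltn_ord j; rewrite mnmE val_idx; [|lia]. Qed.
Lemma bmon_hi eps a j : bmon eps a (hi j) = a (n + j.+2)%N.
Proof. by have hj := ltn_ord j; rewrite mnmE val_idx; [rewrite !addnS|lia]. Qed.

Lemma graded_pair_poly a j r :
  isobaric (sgnT T) (sgnT T (lo j) * (a j.+2)%:Z + sgnT T (hi j) * (a (n + j.+2)%N)%:Z - 2 * r%:Z)
    (pair_poly a j r).
Proof.
have hj := ltn_ord j.
have sl : sgnT T (lo j) = if (j < s)%N then -1 else 1.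
  by rewrite /sgnT (idx_lo_Tset sn) //; lia.
have sh : sgnT T (hi j) = 1 by rewrite /sgnT (idx_hi_Tset sn) //; lia.
have X2 e f k : sgnT T (lo j) * e%:Z + sgnT T (hi j) * f%:Z = k ->
    isobaric (sgnT T) k ('X_(lo j) ^+ e * 'X_(hi j) ^+ f : A).
  by move=> <-; apply: isobaricM; apply: isobaricXn.
(* When r exceeds an exponent the truncated subtraction has the wrong degree, but the binomial
   coefficient makes the factor 0. *)
have [bl|gb] := leqP r (a (n + j.+2)%N); last first.
  rewrite /basis_factor (bin_small gb); case: (j < s)%N; rewrite ?mulr0 scale0r;
  exact: isobaric0.
rewrite /basis_factor sl sh; rewrite sl sh in X2; case: (j < s)%N sl X2 => _ X2.
  by apply/isobaricZ/X2; lia.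
have [al|ga] := leqP r (a j.+2); first by apply/isobaricZ/X2; lia.
by rewrite (bin_small ga) mul0n mulr0 mul0r scale0r; apply: isobaric0.
Qed.

Lemma graded_term eps a t k : wdeg (sgnT T) (bmon eps a) = k ->
  graded T k (term eps a t).
Proof.
have so : sgnT T o = 1 by rewrite /sgnT (idx1_Tset sn).
rewrite /wdeg big_idx_ord so mul1r bmon_o => <-.
have hP := @isobaric_prod K _ (sgnT T) _ (index_enum 'I_n) xpredT _
  (fun i : 'I_n => pair_poly a i (t i)) (fun j _ => @graded_pair_poly a j (t j)).
have hO : isobaric (sgnT T) (eps + 2 * \sum_i t i)%N%:Z (one_poly eps (\sum_i t i)%N).
  by apply: isobaricZ; have := @isobaricXn K _ (sgnT T) o (eps + 2 * \sum_i t i); rewrite so mul1r.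
have := isobaricM hO hP; rewrite sumrB -mulr_sumr -(big_morph Posz PoszD (erefl _)).
rewrite PoszD PoszM [X in isobaric _ X](_ : _ = eps%:Z + \sum_(j < n)
   (sgnT T (lo j) * (a j.+2)%:Z + sgnT T (hi j) * (a (n + j.+2)%N)%:Z)); last by ring.
by congr (isobaric _ (_ + _) _); apply: eq_bigr => j _; rewrite bmon_lo bmon_hi.
Qed.

Lemma basis_poly_harmonic eps a k : (eps <= 1)%N -> wdeg (sgnT T) (bmon eps a) = k ->
  harmonic s k (basis_poly eps a).
Proof.
move=> eps1 hk; split; last by rewrite -Delta_opE // Delta_basis_poly.
by rewrite basis_polyE; apply: isobaric_sum => r _; apply: graded_term.
Qed.

(** Every term with r nonzero is divisible by x_1^2, and r = 0 gives the monomial [bmon eps a]. The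
    coefficients of degree at most 1 in x_1 thus serve as coordinates. *)
Lemma mcoeff_basis_poly eps a mu : (mu o < 2)%N ->
  (basis_poly eps a)@_mu = (bmon eps a == mu)%:R.
Proof.
move=> mu2; pose r0 : n.-tuple 'I_(box a).+1 := [tuple ord0 | i < n].
rewrite basis_polyE raddf_sum /= (bigD1 r0) //= big1 => [|r rr0].
  rewrite addr0 /term big1 => [|i _]; last by rewrite tnth_mktuple.
  rewrite -mcoeffX; congr (_@_mu); rewrite mpolyXE_id big_idx_ord bmon_o; congr (_ * _).
    rewrite /basis_head muln0 addn0 expr0 mul1r fact0 muln1 divff ?scale1r //.
    by rewrite pnatr_eq0 -lt0n fact_gt0.
  apply: eq_bigr => j _; rewrite tnth_mktuple bmon_lo bmon_hi /basis_factor.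
  by case: (j < s)%N; rewrite !bin0 ?fact0 ?expr0 ?muln1 ?mulr1 scale1r ?addn0 ?subn0.
have [j tj] : exists j, (0 < tnth r j)%N.
  apply/existsP; apply: contraNT rr0; rewrite negb_exists => /forallP r0'.
  apply/eqP/eq_from_tnth => i; apply/val_inj; rewrite tnth_mktuple /=.
  by have := r0' i; rewrite -eqn0Ngt => /eqP.
have : (0 < \sum_i tnth r i)%N by rewrite (bigD1 j) //= addn_gt0 tj.
rewrite /term; case: (\sum_i _)%N => // m _; rewrite /basis_head -scalerAl mcoeffZ.
rewrite (_ : (eps + 2 * m.+1)%N = (eps + 2 * m).+2); last by lia.
rewrite ['X_o ^+ _.+2]exprS ['X_o ^+ _.+1]exprS -!['X_o * _ * _]mulrA mcoeff_mulX.
case: ifP => m0; last by rewrite mulr0.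
by rewrite mcoeff_mulX ifF ?mulr0 // mnmBE mnm1E eqxx; lia.
Qed.

Lemma mcoeff_pair_op j (f : A) e : (forall mu, mu o = e -> f@_mu = 0) ->
  forall mu, mu o = e -> (pair_op j f)@_mu = 0.
Proof.
have dX b (g : A) : b != o -> (forall mu, mu o = e -> g@_mu = 0) ->
    forall mu, mu o = e -> g^`M(b)@_mu = 0.
  move=> /negPf bo hg mu muo; rewrite mcoeff_deriv hg ?mul0rn //.
  by rewrite mnmDE mnm1E bo addn0.
move=> hf mu muo; rewrite /lap_pair; case: (j < s)%N.
  rewrite mcoeffN mcoeff_mulX; case: ifP => _; rewrite ?oppr0 // dX ?oppr0 ?hi_o //.
  by rewrite mnmBE mnm1E lo_o subn0.
by apply: (dX); rewrite ?lo_o //; apply: (dX); rewrite ?hi_o.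
Qed.

(** The equation expresses the second x_1-derivative of f through operators that preserve the
    exponent of x_1, so the coefficients at exponent e are determined by those at e - 2. *)
Lemma harmonic_low_eq0 (f : A) : @Delta_op K n s f = 0 ->
  (forall mu, (mu o < 2)%N -> f@_mu = 0) -> f = 0.
Proof.
rewrite Delta_op_pair // => /eqP; rewrite addr_eq0 => /eqP df low.
suff H e mu : mu o = e -> f@_mu = 0 by apply/mpolyP => mu; rewrite (H (mu o) mu) ?mcoeff0.
elim/ltn_ind: e mu => e IHe mu muo; have [/low//|ge2] := ltnP (mu o) 2.
pose nu := (mu - U_(o) - U_(o))%MM.
have E : (nu + U_(o) + U_(o))%MM = mu.
  by rewrite !mnm_subK // ?mnmBE ?mnm1E ?eqxx; lia.
have nuo : nu o = (e - 2)%N by rewrite !mnmBE mnm1E eqxx muo; lia.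
have := congr1 (mcoeff nu) df; rewrite !mcoeff_deriv E mcoeffN mcoeffZ raddf_sum big1 /=.
  by move/eqP; rewrite mulr0 oppr0 !mulrn_eq0 => /eqP.
move=> j _; apply: (@mcoeff_pair_op j f (e - 2)%N) => // x xo; apply: IHe xo; lia.
Qed.

End BasisPoly.

(** * The basis theorem *)

Section BasisTheorem.
Context (K : numFieldType) (n s : nat).
Hypothesis sn : (s < n)%N.
Local Notation T := (Tset n s).
Local Notation A := {mpoly K[n.*2.+1]}.
Local Notation o := (idx n 1).
Local Notation basis_poly := (@basis_poly K n s).
Implicit Types (eps : nat) (a : nat -> nat) (mu : 'X_{1..n.*2.+1}) (f : A).

Lemma wdeg_bmon eps a : wdeg (sgnT T) (bmon n eps a) =
  eps%:Z + \sum_(s.+2 <= p < n.*2.+2) (a p)%:Z - \sum_(2 <= p < s.+2) (a p)%:Z.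
Proof.
pose G i : int := (if (1 <= i <= s)%N then -1 else 1) * (if i == 0%N then eps else a i.+1)%:Z.
transitivity (\sum_(b < n.*2.+1) G b).
  by apply: eq_bigr => b _; rewrite /G /bmon mnmE /sgnT inE ltnS.
rewrite -(big_mkord xpredT G) big_ltn // {1}/G mul1r -addrA; congr (_ + _).
rewrite (@big_cat_nat _ _ _ s.+1) //=; last by lia.
rewrite addrC; congr (_ + _).
  rewrite [RHS]big_add1; apply: eq_big_nat => i hi.
  by rewrite /G !ifF ?mul1r //; lia.
rewrite [in RHS]big_add1 -sumrN; apply: eq_big_nat => i hi.
by rewrite /G ifT ?ifF ?mulN1r //; lia.
Qed.

Lemma basis_poly_bmon eps eps' a a' : (eps <= 1)%N -> (eps' <= 1)%N ->
  bmon n eps a = bmon n eps' a' -> basis_poly eps a = basis_poly eps' a'.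
Proof.
move=> e1 e1' E; apply/eqP; rewrite -subr_eq0; apply/eqP; apply: (harmonic_low_eq0 sn).
  by rewrite Delta_opE // linearB /= -!Delta_opE // !Delta_basis_poly // subrr.
by move=> mu mu2; rewrite mcoeffB !mcoeff_basis_poly // E subrr.
Qed.

Lemma H_basis_lin_indep k : lin_indep (@H_basis_set K n s k).
Proof.
move=> m b c b_inj hb bc0 i; have [eps [a [e1 _ Ei]]] := hb i.
have := congr1 (mcoeff (bmon n eps a)) bc0; rewrite mcoeff0 raddf_sum /= (bigD1 i) //=.
have lo2 : (bmon n eps a o < 2)%N by rewrite bmon_o.
rewrite mcoeffZ Ei mcoeff_basis_poly // eqxx mulr1 big1 ?addr0 // => j ji.
have [eps' [a' [e1' _ Ej]]] := hb j; rewrite mcoeffZ Ej mcoeff_basis_poly //.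
case: eqP => [E|_]; last by rewrite mulr0.
by case/eqP: ji; apply: b_inj; rewrite Ei Ej; apply: basis_poly_bmon.
Qed.

Lemma bmonK mu : bmon n (mu o) (fun p => mu (idx n p)) = mu.
Proof.
apply/mnmP => i; rewrite mnmE; case: eqP => [i0|_]; congr (mu _).
  by apply: val_inj; rewrite /= val_idx ?i0.
by apply: val_inj; rewrite /= val_idx // ltnW.
Qed.

Lemma H_graded_basis k : is_basis (@H_graded K n s k) (@H_basis_set K n s k).
Proof.
split=> [|f]; first exact: H_basis_lin_indep.
have Hb eps a g : (eps <= 1)%N -> wdeg (sgnT T) (bmon n eps a) = k ->
  g = basis_poly eps a -> harmonic s k g by move=> ? ? ->; apply: basis_poly_harmonic.
split=> [/(H_gradedP sn)[fk lf]|[m [b [c [hb ->]]]]]; last first.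
  apply/(H_gradedP sn); apply: (subspace_sum _ (@harmonic_subspace K n s k)).
  by move=> i; have [eps [a [e1 hk E]]] := hb i; apply: Hb E => //; rewrite wdeg_bmon.
pose L := [seq mu : 'X_{1..n.*2.+1} <- msupp f | (mu o < 2)%N].
pose B mu := basis_poly (mu o) (fun p => mu (idx n p)).
have B1 mu : (mu o < 2)%N -> (mu o <= 1)%N by [].
(* The two sides are harmonic with the same coefficients of degree at most 1 in x_1, so
   [harmonic_low_eq0] identifies them. *)
suff -> : f = \sum_(mu <- L) f@_mu *: B mu.
  exists (size L), (fun i => B (tnth (in_tuple L) i)), (fun i => f@_(tnth (in_tuple L) i)).
  split; last by rewrite big_tnth.
  move=> i; have := mem_tnth i (in_tuple L); set mu := tnth _ _.
  rewrite /L mem_filter mcoeff_msupp => /andP[mu2 fmu].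
  exists (mu o), (fun p => mu (idx n p)); split=> //.
  by rewrite -wdeg_bmon bmonK; apply: fk.
apply/eqP; rewrite -subr_eq0; apply/eqP; apply: (harmonic_low_eq0 sn).
  rewrite Delta_opE // linearB /= lf sub0r (linear_sum (laplacian T)) /= big_seq big1 ?oppr0 // => mu.
  rewrite /L mem_filter => /andP[mu2 _]; rewrite linearZ /= -Delta_opE //.
  by rewrite Delta_basis_poly ?scaler0.
move=> nu nu2; rewrite mcoeffB raddf_sum /=.
rewrite (eq_big_seq (fun mu => f@_mu * (mu == nu)%:R)) => [|mu]; last first.
  by rewrite /L mem_filter mcoeffZ mcoeff_basis_poly // bmonK.
have [fnu|fnu] := eqVneq f@_nu 0.
  rewrite fnu big1 ?subr0 // => mu _; case: eqP => [->|_]; rewrite ?mulr0 //.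
  by rewrite fnu mul0r.
rewrite (bigD1_seq nu) ?filter_uniq //= ?/L ?mem_filter ?nu2 ?mcoeff_msupp //.
rewrite eqxx mulr1 big1 ?addr0 ?subrr // => mu /negPf ->.
by rewrite mulr0.
Qed.

End BasisTheorem.

(** Serves to evaluate [lam 0] at the coroots, since it is prescribed only on [cartan]. *)
Lemma cartan_coroot (K : numFieldType) n j : (1 <= j <= n)%N -> cartan (coroot K n j).
Proof.
move=> hj; rewrite /coroot; case: ltnP => jn.
  exists 2%N, (fun i : 'I_2 => cartan_mx K n (j + i)), (fun i : 'I_2 => if i == 0 then 1 else -1).
  split=> [i|]; first by apply: CartanGen; have := ltn_ord i; lia.
  rewrite !big_ord_recl big_ord0 addr0 /= /bump /= addn0 addn1 scale1r scaleN1r.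
  by rewrite /cartan_mx opprB addrA addrAC.
exists 1%N, (fun=> cartan_mx K n n), (fun=> 2); split=> [_|].
  by apply: CartanGen; lia.
by rewrite big_ord1 /cartan_mx addnS addnn.
Qed.

Theorem theorem4p3 (R : realType) (n s : nat) (hs1 : (1 <= s)%N) (hsn : (s < n)%N)
    (lam : nat -> {scalar 'M[R[i]]_(n.*2.+1)}) (hlam : fundamental_weights lam)
    (k : int) :
  let T := Tset n s in
  let A_ := @A_graded R[i] n.*2.+1 T in
  let H_ := @H_graded R[i] n s in
  let x p : {mpoly R[i][n.*2.+1]} := 'X_(idx n p) in
  [/\ is_direct_sum (A_ k) (H_ k) (image_of (@eta_op R[i] n s) (A_ (k - 2))),
      so_irreducible T (H_ k),
      is_basis (H_ k) (@H_basis_set R[i] n s k),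
      0 <= k ->
        [/\ (s < n.-1)%N ->
              highest_weight T (H_ k)
                (fun h => - (k + 1)%:~R * lam s h + k%:~R * lam s.+1 h),
            s = n.-1 ->
              highest_weight T (H_ k)
                (fun h => - (k + 1)%:~R * lam s h + (2 * k)%:~R * lam s.+1 h) &
            singular_vector T (x s.+2 ^+ `|k|) /\
              H_ k (x s.+2 ^+ `|k|)] &
      k < 0 ->
        highest_weight T (H_ k)
          (fun h => (- k)%:~R * lam s.-1 h + (k - 1)%:~R * lam s h) /\
        (singular_vector T (x s.+1 ^+ `|k|) /\
           H_ k (x s.+1 ^+ `|k|))].
Proof.
move=> T A_ H_ x.
have HP (f : {mpoly R[i][n.*2.+1]}) : H_ k f <-> harmonic s k f by apply: H_gradedP.
have hirr : so_irreducible T (H_ k).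
  have -> : H_ k = @harmonic R[i] n s k.
    by apply: boolp.funext => f; apply: boolp.propext.
  apply: harmonic_irreducible => //.
  by exists 'X_[hmon n s k]; [apply: hmon_harmonic | apply: mpolyX_neq0].
have hv : H_ k 'X_[hmon n s k] by apply/HP/hmon_harmonic.
have hsing : singular_vector T ('X_[hmon n s k] : {mpoly R[i][n.*2.+1]}).
  exact: hmon_singular.
have hw mu : scalar mu ->
    (forall j, (1 <= j < n)%N -> mu (coroot R[i] n j) = (hwt s k j - hwt s k j.+1)%:~R) ->
    mu (coroot R[i] n n) = (2 * hwt s k n)%:~R -> highest_weight T (H_ k) mu.
  by move=> h1 h2 h3; split=> //; exists 'X_[hmon n s k]; split=> //; apply: hmon_weight.
case: hlam => lam0 lamE.
have scal (a b : R[i]) (f g : {scalar 'M[R[i]]_(n.*2.+1)}) : scalar (fun h => a * f h + b * g h).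
  by move=> c u v; rewrite !linearP /=; ring.
(* Casting the Kronecker deltas through the integers reduces every weight identity to one between
   integers. *)
have bE (b : bool) : b%:R = (b : nat)%:Z%:~R :> R[i] by [].
have xE c e : 'X_(idx n c) ^+ e = 'X_[(U_(idx n c) *+ e)%MM] :> {mpoly R[i][n.*2.+1]}.
  by rewrite mpolyXn.
split; [exact: A_graded_direct_sum | exact: hirr | exact: H_graded_basis | | ].
- move=> k0; have hp : hpos s k = s.+1 by rewrite /hpos k0.
  have E : x s.+2 ^+ `|k| = 'X_[hmon n s k] by rewrite /x xE /hmon /hvar k0.
  split=> [s_n|s_n|]; last by rewrite E; split; [exact: hsing | exact: hv].
  + apply: hw; [exact: scal | move=> j hj |]; rewrite !lamE; try lia;
      rewrite !bE -rmorphN -!rmorphM -rmorphD; congr intr; rewrite /hwt hp.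
      by case: (ltngtP j s) => ?; do !case: eqP => ? /=; lia.
    by do !case: eqP => ? /=; lia.
  + apply: hw; [exact: scal | move=> j hj |]; rewrite !lamE; try lia;
      rewrite !bE -rmorphN -!rmorphM -rmorphD; congr intr; rewrite /hwt hp.
      by case: (ltngtP j s) => ?; do !case: eqP => ? /=; lia.
    by do !case: eqP => ? /=; lia.
- move=> k0; have hp : hpos s k = s by rewrite /hpos leNgt k0.
  have E : x s.+1 ^+ `|k| = 'X_[hmon n s k] by rewrite /x xE /hmon /hvar leNgt k0.
  split; last by rewrite E; split; [exact: hsing | exact: hv].
  (* The index s.-1 is 0 when s = 1, so the dual-basis relation is extended to i = 0. *)
  have lamE' i j : (i <= n)%N -> (1 <= j <= n)%N -> lam i (coroot R[i] n j) = (i == j)%:R.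
    move=> i_n hj; case: i i_n => [_|i i_n]; last exact: lamE.
    rewrite lam0; first by case: j hj.
    exact: cartan_coroot.
  apply: hw; [exact: scal | move=> j hj |]; rewrite !lamE'; try lia;
    rewrite !bE -!rmorphM -rmorphD; congr intr; rewrite /hwt hp.
    by case: (ltngtP j s) => ?; do !case: eqP => ? /=; lia.
  by do !case: eqP => ? /=; lia.
Qed.
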